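(* Let $\ell_1,\ell_2$ be positive integers and let $(a,b)\in\mathbb{Z}^2$ be a primitive vector lying strictly in the first quadrant. If $f_{a,b}\neq 1$ in the ordered product factorization $T_{\ell_2}^{-1}\circ S_{\ell_1}\circ T_{\ell_2}\circ S_{\ell_1}^{-1}=\prod^{\rightarrow}\theta_{(a,b),f_{a,b}}$, then $(a,b)$ is permissible for the pair $(\ell_1,\ell_2)$.
   Context: Tropical vertex group. For a nonzero vector $(a,b)\in\mathbb{Z}^2$ and $f=1+t\,x^ay^b\,g(x^ay^b,t)$ with $g(z,t)\in\mathbb{C}[z][[t]]$, let $\theta_{(a,b),f}$ be the $\mathbb{C}[[t]]$-algebra automorphism of $\mathbb{C}[x,x^{-1},y,y^{-1}][[t]]$ with $\theta_{(a,b),f}(x)=x\cdot f^{-b}$, $\theta_{(a,b),f}(y)=y\cdot f^{a}$. The tropical vertex group $H$ is the completion with respect to $(t)\subset\mathbb{C}[[t]]$ of the subgroup generated by all such elements; infinite products make sense in $H$ when only finitely many factors are nontrivial mod $t^k$ for each $k$. Composition $\circ$ is composition of algebra automorphisms. Let $S_{\ell_1}=\theta_{(1,0),(1+tx)^{\ell_1}}$ and $T_{\ell_2}=\theta_{(0,1),(1+ty)^{\ell_2}}$. There is a unique factorization $$T_{\ell_2}^{-1}\circ S_{\ell_1}\circ T_{\ell_2}\circ S_{\ell_1}^{-1}=\prod^{\rightarrow}\theta_{(a,b),f_{a,b}},\qquad f_{a,b}\in\mathbb{C}[x^ay^b][[t]],$$ over all primitive $(a,b)\in\mathbb{Z}^2$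 with $a,b>0$ (primitive: $\gcd(a,b)=1$). The factors are ordered by slope: in the written composition, slopes $b/a$ decrease from left to right, so that the factors are applied in order of increasing slope (for example $T_2^{-1}\circ S_1\circ T_2\circ S_1^{-1}=\theta_{(1,2),1+t^3xy^2}\circ\theta_{(1,1),(1+t^2xy)^2}$). Permissibility. An ordered partition of length $\ell$ is a sequence $p_1+\cdots+p_\ell$ of $\ell$ non-negative integers; its size is the sum of its parts. A primitive vector $(a,b)$ strictly in the first quadrant ($a,b>0$) is permissible for $(\ell_1,\ell_2)$ if there exist an integer $k>0$ and ordered partitions $\mathbf{P}_a=p_1+\cdots+p_{\ell_1}$ of size $ak$ and $\mathbf{P}_b=p'_1+\cdots+p'_{\ell_2}$ of size $bk$ such that $$abk^2-k-\sum_{i=1}^{\ell_1}p_i^2-\sum_{j=1}^{\ell_2}(p'_j)^2+2\ge 0.$$ *)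

(* Defs.v *)
From HB Require Import structures.
From mathcomp Require Import all_boot all_order all_algebra.
From mathcomp Require Import finmap monalg complex boolp reals.

Set Implicit Arguments.
Unset Strict Implicit.
Unset Printing Implicit Defensive.

Import Order.TTheory GRing.Theory Num.Theory.
Local Open Scope ring_scope.

(******************************************************************************)
(*  laurent C  ==  C[x, x^-1, y, y^-1], the group algebra of Z^2: finitely    *)
(*                 supported functions int * int -> C; p@_(i, j) is the       *)
(*                 coefficient of x^i y^j.                                    *)
(*  tseries L  ==  L[[t]]; tcoef u n is the coefficient of t^n.               *)
(*  tvring C   ==  C[x, x^-1, y, y^-1][[t]].                                  *)
(******************************************************************************)

(* The ring structure that monalg puts on {malg C[K]} requires that only the  *)
(* neutral element of the monoid K be invertible, so it does not apply to     *)
(* K = Z^2; only the additive structure can be reused.                        *)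
Section Laurent.
Variable C : comNzRingType.

Definition laurent : Type := {malg C[(int * int)%type]}.

HB.instance Definition _ := GRing.Zmodule.copy laurent {malg C[(int * int)%type]}.

Definition lmonom (v : int * int) (c : C) : laurent := mkmalgU v c.

Definition lmul (p q : laurent) : laurent :=
  \sum_(v <- msupp p) \sum_(w <- msupp q)
    lmonom (v + w) (mcoeff v p * mcoeff w q).

Fact lmonom_is_zmod_morphism v : zmod_morphism (lmonom v).
Proof. by move=> c d; rewrite /lmonom monalgUB. Qed.

HB.instance Definition _ v :=
  GRing.isZmodMorphism.Build C laurent (lmonom v) (lmonom_is_zmod_morphism v).

Lemma lmonom0 v : lmonom v 0 = 0.
Proof. exact: monalgU0. Qed.

Lemma laurentE (p : laurent) :
  p = \sum_(v <- msupp p) lmonom v (mcoeff v p).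
Proof. exact: monalgE. Qed.

Lemma laurent_ind (P : laurent -> Prop) :
  P 0 -> (forall p q, P p -> P q -> P (p + q)) ->
  (forall c v, P (lmonom v c)) -> forall p, P p.
Proof. by move=> P0 PD PU p; rewrite (laurentE p); apply: big_ind. Qed.

Lemma lmulE (d e : {fset (int * int)%type}) (p q : laurent) :
  (msupp p `<=` d)%fset -> (msupp q `<=` e)%fset ->
  lmul p q = \sum_(v <- d) \sum_(w <- e)
    lmonom (v + w) (mcoeff v p * mcoeff w q).
Proof.
move=> pd qe; rewrite /lmul (big_fset_incl _ pd) /=; last first.
  move=> v _ /mcoeff_outdom ->.
  by rewrite big1 // => w _; rewrite mul0r lmonom0.
apply: eq_bigr => v _; rewrite (big_fset_incl _ qe) //= => w _.
by move=> /mcoeff_outdom ->; rewrite mulr0 lmonom0.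
Qed.

Lemma lmulC : commutative lmul.
Proof.
move=> p q; rewrite /lmul exchange_big /=.
by apply: eq_bigr => w _; apply: eq_bigr => v _; rewrite mulrC addrC.
Qed.

Lemma lmulDl : left_distributive lmul +%R.
Proof.
move=> p q r; set d := (msupp p `|` msupp q)%fset.
have pd : (msupp p `<=` d)%fset by exact: fsubsetUl.
have qd : (msupp q `<=` d)%fset by exact: fsubsetUr.
have pqd : (msupp (p + q) `<=` d)%fset by exact: msuppD_le.
have rr := fsubset_refl (msupp r).
rewrite (lmulE pqd rr) (lmulE pd rr) (lmulE qd rr) -big_split /=.
apply: eq_bigr => v _; rewrite -big_split /=; apply: eq_bigr => w _.
by rewrite [mcoeff v _]mcoeffD mulrDl [LHS](raddfD (lmonom _)).
Qed.

Lemma lmulDr : right_distributive lmul +%R.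
Proof. by move=> p q r; rewrite lmulC lmulDl ![lmul _ p]lmulC. Qed.

Lemma lmul0 p : lmul p 0 = 0.
Proof. by apply: (addrI (lmul p 0)); rewrite -lmulDr !addr0. Qed.

Lemma lmulUU c d v w :
  lmul (lmonom v c) (lmonom w d) = lmonom (v + w) (c * d).
Proof.
rewrite (lmulE msuppU_le msuppU_le) big_seq_fset1 big_seq_fset1.
by rewrite /lmonom !mcoeffUU.
Qed.

Definition lone : laurent := lmonom 0 1.

Lemma lmul1 : left_id lone lmul.
Proof.
elim/laurent_ind => [|p q IHp IHq|c v]; first exact: lmul0.
  by rewrite lmulDr IHp IHq.
by rewrite lmulUU mul1r add0r.
Qed.

Lemma lmulA : associative lmul.
Proof.
move=> p q r; elim/laurent_ind: r => [|r s IHr IHs|e u].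
- by rewrite !lmul0.
- by rewrite !lmulDr IHr IHs.
elim/laurent_ind: q => [|r s IHr IHs|d w].
- by rewrite [lmul p 0]lmul0 ![lmul 0 _]lmulC !lmul0.
- by rewrite !(lmulDl, lmulDr) IHr IHs.
elim/laurent_ind: p => [|r s IHr IHs|c v].
- by rewrite ![lmul 0 _]lmulC !lmul0 lmulC lmul0.
- by rewrite !lmulDl IHr IHs.
by rewrite !lmulUU mulrA addrA.
Qed.

Fact lone_neq0 : lone != 0.
Proof. by rewrite /lone /lmonom monalgU_eq0 oner_neq0. Qed.

HB.instance Definition _ := GRing.Zmodule_isComNzRing.Build laurent
  lmulA lmulC lmul1 lmulDl lone_neq0.

Definition laurentC (c : C) : laurent := lmonom 0 c.

Definition lmon (v : int * int) : laurent := lmonom v 1.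

End Laurent.

Record tseries (L : Type) := TSeries { tcoef : nat -> L }.

Lemma tseriesP (L : Type) (u v : tseries L) : tcoef u =1 tcoef v -> u = v.
Proof. by case: u v => [u] [v] /= /funext ->. Qed.

HB.instance Definition _ (L : Type) := gen_eqMixin (tseries L).
HB.instance Definition _ (L : Type) := gen_choiceMixin (tseries L).

Section TSeriesRing.
Variable L : comNzRingType.
Implicit Types u v w : tseries L.

Definition tzero : tseries L := TSeries (fun=> 0).
Definition topp u : tseries L := TSeries (fun n => - tcoef u n).
Definition tadd u v : tseries L := TSeries (fun n => tcoef u n + tcoef v n).
Definition tmul u v : tseries L :=
  TSeries (fun n => \sum_(i < n.+1) tcoef u i * tcoef v (n - i)).

Definition tconst (c : L) : tseries L :=
  TSeries (fun n => if n == 0%N then c else 0).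
Definition tvar : tseries L := TSeries (fun n => (n == 1%N)%:R).

Fact taddA : associative tadd.
Proof. by move=> u v w; apply: tseriesP => n /=; rewrite addrA. Qed.
Fact taddC : commutative tadd.
Proof. by move=> u v; apply: tseriesP => n /=; rewrite addrC. Qed.
Fact tadd0 : left_id tzero tadd.
Proof. by move=> u; apply: tseriesP => n /=; rewrite add0r. Qed.
Fact taddN : left_inverse tzero topp tadd.
Proof. by move=> u; apply: tseriesP => n /=; rewrite addNr. Qed.

HB.instance Definition _ :=
  GRing.isZmodule.Build (tseries L) taddA taddC tadd0 taddN.

Definition ttrunc N u : {poly L} := \poly_(i < N) tcoef u i.

Lemma tcoef_mul N u v (p q : {poly L}) n : (n < N)%N ->
  (forall i, (i < N)%N -> p`_i = tcoef u i) ->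
  (forall i, (i < N)%N -> q`_i = tcoef v i) ->
  (p * q)`_n = tcoef (tmul u v) n.
Proof.
move=> nN pu qv; rewrite coefM /=; apply: eq_bigr => i _.
rewrite pu ?qv //; first exact: leq_ltn_trans (leq_subr _ _) nN.
by apply: leq_ltn_trans nN; rewrite -ltnS.
Qed.

Lemma ttruncE N u i : (i < N)%N -> (ttrunc N u)`_i = tcoef u i.
Proof. by move=> iN; rewrite coef_poly iN. Qed.

Fact tmulA : associative tmul.
Proof.
move=> u v w; apply: tseriesP => n.
pose T := ttrunc n.+1; have TE := @ttruncE n.+1.
rewrite -(@tcoef_mul n.+1 _ _ (T u) (T v * T w)) //; [| exact: TE |].
  rewrite mulrA (@tcoef_mul n.+1 (tmul u v) w) //; last exact: TE.
  by move=> i iN; apply: (@tcoef_mul n.+1) => //; exact: TE.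
by move=> i iN; apply: (@tcoef_mul n.+1) => //; exact: TE.
Qed.

Fact tmulC : commutative tmul.
Proof.
move=> u v; apply: tseriesP => n; have TE := @ttruncE n.+1.
rewrite -(@tcoef_mul n.+1 _ _ _ _ n _ (TE u) (TE v)) // mulrC.
exact: tcoef_mul (TE v) (TE u).
Qed.

Fact tmul1 : left_id (tconst 1) tmul.
Proof.
move=> u; apply: tseriesP => n /=.
by rewrite big_ord_recl /= mul1r subn0 big1 ?addr0 // => i _; rewrite mul0r.
Qed.

Fact tmulDl : left_distributive tmul +%R.
Proof.
move=> u v w; apply: tseriesP => n /=; rewrite -big_split /=.
by apply: eq_bigr => i _; rewrite mulrDl.
Qed.

Fact tone_neq0 : tconst 1 != 0.
Proof.
by apply/eqP => /(congr1 (fun u => tcoef u 0)) /eqP; rewrite /= oner_eq0.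
Qed.

HB.instance Definition _ := GRing.Zmodule_isComNzRing.Build (tseries L)
  tmulA tmulC tmul1 tmulDl tone_neq0.

(* The true units and inverses of L[[t]], chosen classically: with them       *)
(* "f ^ m" is available for m : int, as soon as f is invertible.              *)
Definition tunit : pred (tseries L) := fun u => `[< exists v, v * u = 1 >].
Definition tinv u : tseries L :=
  if pselect (exists v, v * u = 1) is left e then projT1 (cid e) else u.

Fact tmulV : {in tunit, left_inverse 1 tinv *%R}.
Proof.
move=> u /asboolP e; rewrite /tinv; case: pselect => // e'.
exact: projT2 (cid e').
Qed.

Fact tunitPl u v : v * u = 1 -> tunit u.
Proof. by move=> e; apply/asboolP; exists v. Qed.

Fact tinv_out : {in [predC tunit], tinv =1 id}.
Proof. by move=> u /asboolP e; rewrite /tinv; case: pselect. Qed.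

HB.instance Definition _ := GRing.ComNzRing_hasMulInverse.Build (tseries L)
  tmulV tunitPl tinv_out.

End TSeriesRing.

Definition tmap (L M : Type) (h : L -> M) (u : tseries L) : tseries M :=
  TSeries (fun n => h (tcoef u n)).

Section TropicalVertex.
Variable C : comNzRingType.

Definition tvring : Type := tseries (laurent C).
HB.instance Definition _ := GRing.ComUnitRing.copy tvring (tseries (laurent C)).

Definition tvt : tvring := tvar (laurent C).
Definition tvmon (v : int * int) : tvring := tconst (lmon C v).
Definition tvx : tvring := tvmon (1, 0).
Definition tvy : tvring := tvmon (0, 1).

(* The structure map C[[t]] -> C[x, x^-1, y, y^-1][[t]].                      *)
Definition tvscalar : tseries C -> tvring := tmap (@laurentC C).

(* g(x^a y^b, t), for g in C[z][[t]] and v = (a, b).                          *)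
Definition tvsubst (v : int * int) : tseries {poly C} -> tvring :=
  tmap (fun p : {poly C} => (map_poly (@laurentC C) p).[lmon C v]).

Definition is_wall_function (v : int * int) (f : tvring) : Prop :=
  exists g : tseries {poly C}, f = 1 + tvt * tvmon v * tvsubst v g.

(* C[[t]]-algebra automorphisms of tvring.                                    *)
Record tvaut := TVAut {
  tvaut_fun :> {rmorphism tvring -> tvring};
  tvaut_inv : tvring -> tvring;
  tvaut_funK : cancel tvaut_fun tvaut_inv;
  tvaut_invK : cancel tvaut_inv tvaut_fun;
  tvaut_scalar : forall c : tseries C, tvaut_fun (tvscalar c) = tvscalar c
}.

(* "phi is theta_(v, f)": a C[[t]]-algebra endomorphism of tvring commutes    *)
(* with multiplication by t, hence is t-adically continuous, so that it is    *)
(* determined by the images of x and y.                                       *)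
Definition is_theta (v : int * int) (f : tvring) (phi : tvaut) : Prop :=
  [/\ v != 0, is_wall_function v f,
      phi tvx = tvx * f ^ (- v.2) & phi tvy = tvy * f ^ v.1].

Definition first_quadrant_primitive (v : int * int) : bool :=
  [&& 0 < v.1, 0 < v.2 & coprimez v.1 v.2].

Definition slope (v : int * int) : rat := v.2%:~R / v.1%:~R.

Definition eq_mod_t (k : nat) (phi psi : tvring -> tvring) : Prop :=
  forall u n, (n < k)%N -> tcoef (phi u) n = tcoef (psi u) n.

Definition tvcompose (th : int * int -> tvaut) (s : seq (int * int)) :
    tvring -> tvring :=
  foldr (fun v phi => th v \o phi) id s.

(* The slope-ordered infinite product of the th v converges to phi: for each  *)
(* k only the finitely many v in s have a th v that is nontrivial mod t^k,    *)
(* and their product, written with slopes decreasing from left to right, is   *)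
(* phi mod t^k.                                                               *)
Definition is_ordered_product (th : int * int -> tvaut)
    (phi : tvring -> tvring) : Prop :=
  forall k : nat, exists s : seq (int * int),
    [/\ all first_quadrant_primitive s,
        sorted (fun v w => slope w < slope v) s,
        forall v, first_quadrant_primitive v -> v \notin s ->
          eq_mod_t k (th v) id
      & eq_mod_t k phi (tvcompose th s)].

(* The family of the f_(a, b), indexed by v = (a, b); the values of f outside *)
(* the primitive vectors of the open first quadrant are irrelevant.           *)
Definition is_commutator_factorization (l1 l2 : nat)
    (f : int * int -> tvring) : Prop :=
  exists (S T : tvaut) (th : int * int -> tvaut),
    [/\ is_theta (1, 0) ((1 + tvt * tvx) ^+ l1) S,
        is_theta (0, 1) ((1 + tvt * tvy) ^+ l2) T,
        forall v, first_quadrant_primitive v -> is_theta v (f v) (th v)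
      & is_ordered_product th (tvaut_inv T \o S \o T \o tvaut_inv S)].

End TropicalVertex.

Definition permissible (l1 l2 : nat) (v : int * int) : Prop :=
  first_quadrant_primitive v /\
  exists (k : nat) (p : l1.-tuple nat) (q : l2.-tuple nat),
    [/\ (0 < k)%N,
        (\sum_(i < l1) tnth p i)%:Z = v.1 * k%:Z,
        (\sum_(j < l2) tnth q j)%:Z = v.2 * k%:Z
      & 0 <= v.1 * v.2 * k%:Z ^+ 2 - k%:Z
             - \sum_(i < l1) (tnth p i)%:Z ^+ 2
             - \sum_(j < l2) (tnth q j)%:Z ^+ 2 + 2].

(* Main.v *)
Require Import Defs.
From HB Require Import structures.
From mathcomp Require Import all_boot all_order all_algebra.
From mathcomp Require Import finmap monalg complex boolp reals.
From mathcomp Require Import zify ring.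

Set Implicit Arguments.
Unset Strict Implicit.
Unset Printing Implicit Defensive.

Import Order.TTheory GRing.Theory Num.Theory.
Local Open Scope ring_scope.

(** A ray is a primitive direction (a, b) with a >= 0 and b > 0, so that (0, 1),
    the direction of T, is one.  The argument rests on a reflection of the rays.

    Put U = S T S^-1.  The factorization says that U is the slope-ordered
    product of T, along (0, 1), and of the theta_(a, b).  Moreover
    U x = x / W^l2 with W = 1 + t y (1 + t x)^l1, and only the image of x
    matters: theta_(a, b) multiplies x by f^-b with b > 0.

    Supports.  W only involves monomials t^(i + j) x^i y^j with 0 <= i <= l1 * j.
    By induction on the t-order, the same holds for all f_(a, b): at the first
    order where it could fail, the effect on x of the product is the sum of the
    effects of the factors, and different rays have no monomial in common
    ([cone_ray]).  In particular f_(a, b) = 1 when a > l1 * b.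

    Symmetry.  Let sigma (i, j) = (l1 * j - i, j).  It reverses the order of the
    slopes and changes the sign of the symplectic form, and W is invariant under
    it.  Conjugating by the corresponding involution and inverting thus turns the
    ordered product for U into another one for U.  Two such products agree
    factor by factor, by induction on the degree in y; hence f_(a, b) and
    f_(l1 * b - a, b) have the same coefficients up to sigma
    ([ray_reflection]).  Exchanging x and y gives the mirror statement for
    (a, b) and (a, l2 * a - b) ([factorization_swap]).

    Both inductions are instances of one linearization principle in a filtered
    ring ([filt_expz], [filt_foldr]): for series with constant term 1,
    products and powers are additive modulo the next step of the filtration.

    Partitions.  Let Q = l1 * l2 * a * b - l2 * a^2 - l1 * b^2.  If Q > 0, the
    balanced partitions for k = l1 * l2 show that (a, b) is permissible; if
    Q = 0, then a divides l1 and b divides l2, and k = 1 with parts 0 and 1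
    works.  If Q < 0, one of the reflections decreases a + b or ends with
    a = l1, b = 1 or with a = 1, b = l2, which are permissible; and
    permissibility is preserved by the reflections p_i |-> b * k - p_i of the
    parts ([reflection_permissible]). *)

(** * Coefficients of Laurent polynomials and of power series in t *)

Section Coefficients.
Variable C : comNzRingType.
Implicit Types (p q : laurent C) (u f g : tvring C) (v w : int * int).

(** The coefficient of the monomial of exponent v, as an additive map on the
    ring of Laurent polynomials. *)
Definition lcoef v p : C := mcoeff v p.

Lemma lcoefP p q : (forall v, lcoef v p = lcoef v q) -> p = q.
Proof. by move=> pq; apply/malgP. Qed.

Fact lcoef_is_zmod_morphism v : zmod_morphism (lcoef v).
Proof. by move=> p q; apply: mcoeffB. Qed.

HB.instance Definition _ v :=
  GRing.isZmodMorphism.Build (laurent C) C (lcoef v)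
    (lcoef_is_zmod_morphism v).

Lemma lcoefU v c w : lcoef w (lmonom v c) = c *+ (v == w).
Proof. exact: mcoeffU. Qed.

Lemma lcoef1 w : lcoef w 1 = (w == 0)%:R.
Proof. by rewrite [LHS]lcoefU eq_sym. Qed.

Lemma lcoef_supp p v : v \notin msupp p -> lcoef v p = 0.
Proof. exact: mcoeff_outdom. Qed.

Lemma lcoefM p q v :
  lcoef v (p * q) = \sum_(w <- msupp p) lcoef w p * lcoef (v - w) q.
Proof.
rewrite [p * q]/(lmul p q) /lmul raddf_sum; apply: eq_bigr => w _.
rewrite raddf_sum /=.
under eq_bigr => w' _ do rewrite lcoefU.
have addK w' : (w + w' == v) = (w' == v - w)
  by rewrite eq_sym (addrC w w') -subr_eq eq_sym.
under eq_bigr => w' _ do rewrite addK.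
have [vin|vout] := boolP (v - w \in msupp q).
  rewrite (bigD1_seq (v - w)) ?fset_uniq //= eqxx mulr1n.
  by rewrite big1 ?addr0 // => w' /negPf ->.
rewrite (lcoef_supp vout) mulr0 big_seq big1 // => w' w'q.
by case: eqP => // vE; rewrite vE (negPf vout) in w'q.
Qed.

End Coefficients.

Section Series.
Variable C : comNzRingType.
Implicit Types (p q : laurent C) (u f g : tvring C) (v w : int * int).

(** The coefficient of t^n x^i y^j, for v = (i, j). *)
Definition tcf n v u : C := lcoef v (tcoef u n).

Lemma tvringP u f : (forall n v, tcf n v u = tcf n v f) -> u = f.
Proof. by move=> uf; apply: tseriesP => n; apply: lcoefP => v; apply: uf. Qed.

Fact tcf_is_zmod_morphism n v : zmod_morphism (tcf n v).
Proof. by move=> u f; rewrite /tcf -raddfB. Qed.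

HB.instance Definition _ n v :=
  GRing.isZmodMorphism.Build (tvring C) C (tcf n v)
    (tcf_is_zmod_morphism n v).

Lemma tcf1 n v : tcf n v 1 = ((n == 0%N) && (v == 0))%:R.
Proof. by rewrite /tcf /=; case: n => [|n]; rewrite ?raddf0 // lcoef1. Qed.

(** The coefficient at (n, v) of the sum over w of u_w x^w (g w), where u_w is
    the series in t multiplying the monomial of exponent w in u.  Products and
    wall-crossing automorphisms are both of this form. *)
Definition twist u (g : int * int -> tvring C) n v : C :=
  \sum_(m < n.+1) \sum_(w <- msupp (tcoef u m))
    tcf m w u * tcf (n - m) (v - w) (g w).

Lemma tcfM n v u f : tcf n v (u * f) = twist u (fun=> f) n v.
Proof.
rewrite /tcf /= raddf_sum; apply: eq_bigr => m _.
by rewrite -[RHS]lcoefM.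
Qed.

(** Congruence modulo t^k. *)
Definition eqt k u f := forall n, (n < k)%N -> tcoef u n = tcoef f n.

Lemma eqt_sym k u f : eqt k u f -> eqt k f u.
Proof. by move=> uf n /uf. Qed.

Lemma eqt_trans k u f g : eqt k u f -> eqt k f g -> eqt k u g.
Proof. by move=> uf fg n nk; rewrite uf // fg. Qed.

Lemma eqtM k u u' f f' : eqt k u u' -> eqt k f f' -> eqt k (u * f) (u' * f').
Proof.
move=> uu ff n nk; apply: eq_bigr => i _.
rewrite uu ?ff //; first exact: leq_ltn_trans (leq_subr _ _) nk.
by apply: leq_ltn_trans nk; rewrite -ltnS.
Qed.

Lemma tcoefD n u f : tcoef (u + f) n = tcoef u n + tcoef f n.
Proof. by []. Qed.

Lemma tcoefB n u f : tcoef (u - f) n = tcoef u n - tcoef f n.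
Proof. by []. Qed.

Lemma tcoef0M u f : tcoef (u * f) 0 = tcoef u 0 * tcoef f 0.
Proof. by rewrite /= big_ord1. Qed.

Lemma tcoef0X u n : tcoef u 0 = 1 -> tcoef (u ^+ n) 0 = 1.
Proof.
by move=> u1; elim: n => // n IHn; rewrite exprS tcoef0M u1 IHn mulr1.
Qed.

Lemma eqt_exp0 u n : tcoef u 0 = 0 -> eqt n (u ^+ n) 0.
Proof.
move=> u0; elim: n => // n IHn m mn; rewrite exprS /= big1 // => i _.
have [->|i0] := posnP i; first by rewrite u0 mul0r.
by rewrite IHn ?mulr0 //; have := ltn_ord i; lia.
Qed.

(** A series with constant term 1 has the geometric inverse. *)
Lemma tvunit u : tcoef u 0 = 1 -> u \is a GRing.unit.
Proof.
move=> u1; pose h := 1 - u.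
have h0 : tcoef h 0 = 0 by rewrite /h tcoefB u1 subrr.
pose s n := \sum_(i < n) h ^+ i.
have sE n k : (n < k)%N -> tcoef (s k) n = tcoef (s n.+1) n.
  move=> /subnKC <-; elim: (k - _)%N => [|j IHj]; rewrite ?addn0 // addnS.
  rewrite [s _]big_ord_recr tcoefD IHj (@eqt_exp0 _ (n.+1 + j)) ?addr0 //.
  exact: leq_addr.
pose f : tvring C := TSeries (fun n => tcoef (s n.+1) n).
apply/asboolP; exists f; apply: tseriesP => n.
transitivity (tcoef (s n.+1 * u) n).
  by apply: (@eqtM n.+1) => // i iN; rewrite sE.
have -> : s n.+1 * u = 1 - h ^+ n.+1.
  by rewrite -[RHS]opprB subrX1 -mulNr opprB subKr mulrC.
by rewrite tcoefB (eqt_exp0 (n := n.+1)) // subr0.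
Qed.

Lemma tcoef0V u : tcoef u 0 = 1 -> tcoef u^-1 0 = 1.
Proof.
move=> u1; have := congr1 (fun f => tcoef f 0) (divrr (tvunit u1)).
by rewrite tcoef0M u1 mul1r.
Qed.

Lemma tcoef0Xz u (z : int) : tcoef u 0 = 1 -> tcoef (u ^ z) 0 = 1.
Proof. by move=> u1; case: z => n; [|apply: tcoef0V]; apply: tcoef0X. Qed.

End Series.

(** * Wall-crossing automorphisms on coefficients *)

Lemma rmorph_monomial (R : comUnitRingType) (phi : {rmorphism R -> R})
    (x y f : R) (a b i j : int) :
    x \is a GRing.unit -> y \is a GRing.unit -> f \is a GRing.unit ->
    phi x = x * f ^ (- b) -> phi y = y * f ^ a ->
  phi (x ^ i * y ^ j) = x ^ i * y ^ j * f ^ (a * j - b * i).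
Proof.
move=> xU yU fU phix phiy; rewrite rmorphM !rmorphXz // phix phiy.
rewrite !exprMz_comm ?unitrXz //; try exact: mulrC.
by rewrite mulrACA !exprz_exp -exprzDr // addrC mulNr.
Qed.

Section Action.
Variable C : comNzRingType.
Implicit Types (p q : laurent C) (u f g : tvring C) (v w : int * int).
Implicit Types (phi : tvaut C).

Fact tconst_is_zmod_morphism : zmod_morphism (@tconst (laurent C) : _ -> tvring C).
Proof. by move=> p q; apply: tseriesP => -[|n] //=; rewrite subr0. Qed.

HB.instance Definition _ :=
  GRing.isZmodMorphism.Build (laurent C) (tvring C)
    (@tconst (laurent C) : _ -> tvring C) tconst_is_zmod_morphism.

Lemma tcoef_constM p u n : tcoef ((tconst p : tvring C) * u) n = p * tcoef u n.
Proof.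
rewrite /= big_ord_recl /= subn0 big1 ?addr0 // => i _; exact: mul0r.
Qed.

Lemma tconstM p q : tconst (p * q) = (tconst p : tvring C) * tconst q.
Proof.
apply: tseriesP => -[|n]; rewrite tcoef_constM //; exact/esym/mulr0.
Qed.

Lemma lmonomM v w (c d : C) : lmonom v c * lmonom w d = lmonom (v + w) (c * d).
Proof. exact: lmulUU. Qed.

Lemma tvmonD v w : tvmon C (v + w) = tvmon C v * tvmon C w.
Proof. by rewrite -tconstM /lmon lmonomM mulr1. Qed.

Lemma tvmon0 : tvmon C 0 = 1.
Proof. by apply: tseriesP. Qed.

Lemma tvmon_unit v : tvmon C v \is a GRing.unit.
Proof. by apply/asboolP; exists (tvmon C (- v)); rewrite -tvmonD addNr tvmon0. Qed.

Lemma tvmonMn v n : tvmon C (v *+ n) = tvmon C v ^+ n.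
Proof. by elim: n => [|n IHn]; rewrite ?tvmon0 // mulrS tvmonD IHn exprS. Qed.

Lemma tvmonMz v (z : int) : tvmon C (v *~ z) = tvmon C v ^ z.
Proof.
case: z => n; first exact: tvmonMn.
rewrite NegzE mulrNz -[LHS](mulrK (tvmon_unit (v *+ n.+1))) -tvmonD addNr.
by rewrite tvmon0 mul1r tvmonMn.
Qed.

Lemma tvmonE v : tvmon C v = tvx C ^ v.1 * tvy C ^ v.2.
Proof.
have vE : v = (1, 0) *~ v.1 + (0, 1) *~ v.2.
  by case: v => i j; congr pair; rewrite !raddfMz /= intz mul0rz ?addr0 ?add0r.
by rewrite {1}vE tvmonD (tvmonMz _ v.1) (tvmonMz _ v.2).
Qed.

Lemma tvscalar_lmonom v (c : C) :
  tvscalar (tconst c) * tvmon C v = tconst (lmonom v c) :> tvring C.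
Proof.
have -> : tvscalar (tconst c) = tconst (lmonom 0 c) :> tvring C.
  by apply: tseriesP => -[|n] //; apply: lmonom0.
by rewrite -tconstM /lmon lmonomM mulr1 add0r.
Qed.

Lemma tvaut_t phi : phi (tvt C) = tvt C.
Proof.
have <- : tvscalar (tvar C) = tvt C; last exact: tvaut_scalar.
by apply: tseriesP => -[|[|n]] //; apply: lmonom0.
Qed.

Lemma tcoef_tM0 u : tcoef (tvt C * u) 0 = 0.
Proof. by rewrite tcoef0M mul0r. Qed.

Lemma tcoef_tMS u n : tcoef (tvt C * u) n.+1 = tcoef u n.
Proof.
rewrite /= !big_ord_recl /= mul0r add0r mul1r subSS subn0.
by rewrite big1 ?addr0 // => i _; apply: mul0r.
Qed.

(** The action on x and y of theta_(v, f), where f is only required to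
    have constant term 1. *)
Definition acts v f phi :=
  [/\ tcoef f 0 = 1, phi (tvx C) = tvx C * f ^ (- v.2)
    & phi (tvy C) = tvy C * f ^ v.1].

(** The symplectic form on exponents. *)
Definition det v w : int := v.1 * w.2 - v.2 * w.1.

Lemma acts_mon v f phi w :
  acts v f phi -> phi (tvmon C w) = tvmon C w * f ^ det v w.
Proof.
case=> /tvunit fU phix phiy; rewrite tvmonE.
exact: rmorph_monomial (tvmon_unit _) (tvmon_unit _) fU phix phiy.
Qed.
End Action.

Section ActionCoefficients.
Variable C : comNzRingType.
Implicit Types (p q : laurent C) (u f g : tvring C) (v w : int * int).
Implicit Types (phi : tvaut C).

Lemma lcoef_monM v (c : C) p w : lcoef w (lmonom v c * p) = c * lcoef (w - v) p.
Proof.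
rewrite mulrC lcoefM; under eq_bigr => w' _ do rewrite lcoefU mulrnAr.
have [wv|wv] := boolP (w - v \in msupp p).
  rewrite (bigD1_seq (w - v)) ?fset_uniq //= subKr eqxx mulr1n.
  rewrite big1 ?addr0 1?mulrC // => w' /negPf w'P.
  by rewrite eq_sym -subr_eq0 addrAC subr_eq0 eq_sym w'P.
rewrite (lcoef_supp wv) mulr0 big_seq big1 // => w' w'p.
case: eqP => // vE; move: wv.
by rewrite vE subKr w'p.
Qed.

Definition tshift u : tvring C := TSeries (fun n => tcoef u n.+1).

Lemma tshiftE u : u = tconst (tcoef u 0) + tvt C * tshift u.
Proof.
apply: tseriesP => -[|n]; rewrite tcoefD ?tcoef_tM0 ?tcoef_tMS ?addr0 //=.
by rewrite add0r.
Qed.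

Lemma acts_const v f phi p n w : acts v f phi ->
  tcf n w (phi (tconst p)) =
  \sum_(w' <- msupp p) lcoef w' p * tcf n (w - w') (f ^ det v w').
Proof.
move=> aphi; rewrite {1}(laurentE p) !raddf_sum /=; apply: eq_bigr => w' _.
rewrite -tvscalar_lmonom rmorphM tvaut_scalar (acts_mon _ aphi) mulrA.
by rewrite tvscalar_lmonom /tcf tcoef_constM lcoef_monM.
Qed.

(** On coefficients, an automorphism of the shape theta_(v, f) is a twisted
    convolution, in which the monomial of exponent w brings in f ^ det v w. *)
Lemma tcf_acts v f phi u n w : acts v f phi ->
  tcf n w (phi u) = twist u (fun w' => f ^ det v w') n w.
Proof.
move=> aphi; elim: n u => [|n IHn] u; rewrite {1}(tshiftE u) !raddfD /=.
  rewrite rmorphM tvaut_t {2}/tcf tcoef_tM0 raddf0 addr0 (acts_const _ _ _ aphi).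
  by rewrite /twist big_ord1.
rewrite rmorphM tvaut_t {2}/tcf tcoef_tMS -/(tcf n w _) IHn.
by rewrite (acts_const _ _ _ aphi) /twist [RHS]big_ord_recl.
Qed.

Lemma acts_eqt v f phi k u g : acts v f phi ->
  eqt k u g -> eqt k (phi u) (phi g).
Proof.
move=> aphi ug n nk; apply: lcoefP => w.
rewrite -/(tcf n w _) -/(tcf n w (phi g)) !(tcf_acts _ _ _ aphi).
apply: eq_bigr => m _; rewrite /tcf ug //.
by apply: leq_ltn_trans nk; rewrite -ltnS.
Qed.

Lemma tcf_twist1 u n w : twist u (fun=> 1) n w = tcf n w u.
Proof. by rewrite -tcfM mulr1. Qed.

Lemma acts1 v phi u : acts v 1 phi -> phi u = u.
Proof.
move=> aphi; apply: tvringP => n w; rewrite (tcf_acts _ _ _ aphi) -[RHS]tcf_twist1.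
by apply: eq_bigr => m _; apply: eq_bigr => w' _; rewrite exp1rz.
Qed.

(** Apart from a scalar in degree 0, u only involves monomials
    t^n x^w with n > 0 and w a positive multiple of v. *)
Definition on_ray v u := forall n w, tcf n w u != 0 ->
  (n = 0%N /\ w = 0) \/ ((0 < n)%N /\ exists k : nat, w = v *+ k.+1).

Lemma det_ray v k : det v (v *+ k) = 0.
Proof. by rewrite /det; case: v => a b; rewrite !raddfMn /= !mulrnAr (mulrC b) subrr. Qed.

(** The form vanishes on multiples of v, so theta_(v, f) fixes its own wall
    function; this makes its inverse another automorphism of the same shape. *)
Lemma acts_fix v f phi : on_ray v f -> acts v f phi -> phi f = f.
Proof.
move=> rf aphi; apply: tvringP => n w.
rewrite (tcf_acts _ _ _ aphi) -[RHS]tcf_twist1.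
apply: eq_bigr => m _; apply: eq_bigr => w' _.
have [->|/rf[[_ ->]|[_ [k ->]]]] := eqVneq (tcf m w' f) 0; first by rewrite !mul0r.
- by rewrite -(mulr0n v) det_ray expr0z.
- by rewrite det_ray expr0z.
Qed.

End ActionCoefficients.

Section Inverse.
Variable C : comNzRingType.
Variable phi : tvaut C.

Let psi : tvring C -> tvring C := tvaut_inv phi.

Fact tvaut_inv_is_zmod_morphism : zmod_morphism psi.
Proof. exact: can2_zmod_morphism (tvaut_funK phi) (tvaut_invK phi). Qed.

Fact tvaut_inv_is_monoid_morphism : monoid_morphism psi.
Proof. exact: can2_monoid_morphism (tvaut_funK phi) (tvaut_invK phi). Qed.

HB.instance Definition _ := GRing.isZmodMorphism.Build _ _ psi
  tvaut_inv_is_zmod_morphism.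
HB.instance Definition _ := GRing.isMonoidMorphism.Build _ _ psi
  tvaut_inv_is_monoid_morphism.

Fact tvaut_inv_scalar c : psi (tvscalar c) = tvscalar c.
Proof. by rewrite -{1}(tvaut_scalar phi c) /psi tvaut_funK. Qed.

(** The inverse of an automorphism, as an automorphism. *)
Definition tvinverse : tvaut C :=
  @TVAut C psi phi (tvaut_invK phi) (tvaut_funK phi) tvaut_inv_scalar.

End Inverse.

Lemma rmorph_inverse (R : comUnitRingType) (phi psi : {rmorphism R -> R})
    (x f : R) (a : int) :
    cancel phi psi -> f \is a GRing.unit -> phi f = f -> phi x = x * f ^ a ->
  psi x = x * f^-1 ^ a.
Proof.
move=> phiK fU phif phix; have psif : psi f = f by rewrite -{1}phif phiK.
have /(congr1 psi) := phix; rewrite phiK rmorphM rmorphXz // psif => xE.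
by rewrite {2}xE exprz_inv -mulrA -exprzDr // subrr expr0z mulr1.
Qed.

Lemma acts_inverse (C : comNzRingType) v f (phi : tvaut C) :
  on_ray v f -> acts v f phi -> acts v f^-1 (tvinverse phi).
Proof.
move=> rf aphi; have phif := acts_fix rf aphi.
case: aphi => f1 phix phiy; have fU := tvunit f1; split.
- exact: tcoef0V.
- exact: (@rmorph_inverse (tvring C) phi (tvinverse phi) _ _ _
           (tvaut_funK phi) fU phif phix).
- exact: (@rmorph_inverse (tvring C) phi (tvinverse phi) _ _ _
           (tvaut_funK phi) fU phif phiy).
Qed.

(** * Linearization in a filtered ring *)

(** V n collects the elements whose components of degree less than n satisfy
    some linear condition, and I the elements without component of degree 0 (and
    subject to conditions of another nature).  In a product of two elements of I,
    the components of degree n only involve those of smaller degree: hence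
    [filtM]. *)
Record filtered (A : comNzRingType) (I : A -> Prop) (V : nat -> A -> Prop) :
    Prop := Filtered {
  filtI0 : I 0;
  filtIB : forall p q, I p -> I q -> I (p - q);
  filtIM : forall p q, I p -> I q -> I (p * q);
  filt0 : forall n, V n 0;
  filtB : forall n p q, V n p -> V n q -> V n (p - q);
  filtS : forall n p, V n.+1 p -> V n p;
  filt1 : forall p, I p -> V 1%N p;
  filtM : forall n p q, (0 < n)%N -> I p -> I q -> V n p -> V n q ->
    V n.+1 (p * q)
}.

Section Linearization.
Variables (A : comNzRingType) (I : A -> Prop) (V : nat -> A -> Prop).
Hypothesis filt : filtered I V.
Implicit Types (p q u : A) (n : nat).

Let I0 := filtI0 filt.
Let IB := filtIB filt.
Let IM := filtIM filt.
Let V0 := filt0 filt.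
Let VB := filtB filt.
Let VS := filtS filt.
Let V1 := filt1 filt.
Let VM := filtM filt.

Lemma filtID p q : I p -> I q -> I (p + q).
Proof. by move=> Ip Iq; rewrite -[q]opprK; apply/IB => //; rewrite -sub0r; apply: IB. Qed.

Lemma filtD n p q : V n p -> V n q -> V n (p + q).
Proof. by move=> Vp Vq; rewrite -[q]opprK; apply/VB => //; rewrite -sub0r; apply: VB. Qed.

Lemma filt_leq n m p : (m <= n)%N -> V n p -> V m p.
Proof. by move=> /subnK <-; elim: (n - m)%N => // k IHk /VS. Qed.

(** Modulo V n.+1, raising to a power z acts on 1 + V n as multiplication by z
    on V n.  The power function E is abstract, so that negative exponents need no
    inverses in A. *)
Lemma filt_expz (E : int -> A) n :
    E 0 = 1 -> (forall z, E (z + 1) = E z * E 1) -> (forall z, I (E z - 1)) ->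
    (0 < n)%N -> V n (E 1 - 1) ->
  forall z, V n (E z - 1) /\ V n.+1 (E z - 1 - (E 1 - 1) *~ z).
Proof.
move=> E0 ED IE n0 V1E.
have step z : E (z + 1) - 1 = (E z - 1) * (E 1 - 1) + (E z - 1) + (E 1 - 1).
  by rewrite ED; ring.
elim/int_rec => [|k [IH1 IH2]|k [IH1 IH2]].
- by rewrite E0 subrr mulr0z subrr.
- rewrite -addn1 PoszD step mulrzDr mulr1z; have VEE := VM n0 (IE k) (IE 1) IH1 V1E.
  split; first by apply: filtD => //; apply: filtD => //; apply: VS.
  set q := (E 1 - 1) *~ k in IH2 *.
  rewrite [X in V _ X](_ : _ = (E k - 1) * (E 1 - 1) + (E k - 1 - q)); last by ring.
  exact: filtD.
set z := - (k.+1 : int).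
have zE : - (k : int) = z + 1 by rewrite /z; lia.
have {}step : E z - 1 = (E (- (k : int)) - 1) - (E 1 - 1) - (E z - 1) * (E 1 - 1).
  by rewrite zE step; ring.
have VE m : (m <= n)%N -> V m (E z - 1).
  elim: m => [|m IHm] mn; first exact/VS/V1.
  have [->|m0] := posnP m; first exact: V1.
  rewrite step; apply: VB; first by apply: (filt_leq mn); apply: VB.
  by apply: VM => //; [apply: IHm; apply: ltnW | apply: filt_leq V1E; apply: ltnW].
split; first exact: VE.
have zz : z = - (k : int) - 1 by rewrite zE addrK.
rewrite {1}step zz mulrzBr mulr1z -zz.
set q := (E 1 - 1) *~ (- (k : int)) in IH2 *.
rewrite [X in V _ X](_ : _ = E (- (k : int)) - 1 - q - (E z - 1) * (E 1 - 1));
  last by ring.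
by apply: VB => //; apply: VM => //; apply: VE.
Qed.

(** A composite of maps Theta_i, each with a factor kappa_i, applied to 1.
    If each Theta_i is the identity on 1 + V n modulo V n.+1, only the sum of the
    kappa_i - 1 remains modulo V n.+1. *)
Lemma filt_foldr (T : eqType) (s : seq T) (Theta : T -> A -> A) (kappa : T -> A) n :
    (0 < n)%N ->
    {in s, forall i, I (kappa i - 1) /\ V n (kappa i - 1)} ->
    {in s, forall i u, I (u - 1) -> V n (u - 1) ->
      I (Theta i u - 1) /\ V n.+1 (Theta i u - u)} ->
  let K := foldr (fun i u => kappa i * Theta i u) 1 s in
  [/\ I (K - 1), V n (K - 1) & V n.+1 (K - 1 - \sum_(i <- s) (kappa i - 1))].
Proof.
move=> n0; elim: s => [|i s IHs] kappaP ThetaP /=.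
  by rewrite big_nil subrr subr0.
have [||IK VK VK'] := IHs.
- by move=> j js; apply: kappaP; rewrite inE js orbT.
- by move=> j js; apply: ThetaP; rewrite inE js orbT.
have [Ik Vk] := kappaP i (mem_head _ _).
have [It Vt] := ThetaP i (mem_head _ _) _ IK VK.
move: It Vt VK'; set K := foldr _ _ _ in IK VK *.
set X := Theta i K; set k := kappa i in Ik Vk *.
move=> IX VX VK'.
have kX : k * X - 1 = (k - 1) * (X - 1) + (k - 1) + (X - 1) by ring.
have VX1 : V n (X - 1) by rewrite -[X](subrK K) -addrA; apply: filtD => //; apply: VS.
have VkX : V n.+1 ((k - 1) * (X - 1)) by apply: VM.
split.
- by rewrite kX; do 2?[apply: filtID => //]; apply: IM.
- by rewrite kX; do 2?[apply: filtD => //]; apply: VS.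
rewrite big_cons kX -/k; set S := \sum_(j <- s) _ in VK' *.
rewrite [Y in V _ Y](_ : _ = (k - 1) * (X - 1) + (X - K) + (K - 1 - S));
  last by ring.
by apply: filtD => //; apply: filtD.
Qed.

Lemma filt_sum (T : eqType) (s : seq T) (kappa G : T -> A) n K :
    V n K -> V n (K - \sum_(i <- s) kappa i) ->
    {in s, forall i, V n (kappa i - G i)} ->
  V n (\sum_(i <- s) G i).
Proof.
move=> VK VKk VkG; have: V n (\sum_(i <- s) (kappa i - G i)).
  rewrite big_seq; elim/big_ind: _ => [|p q|i /VkG //]; first exact: V0.
  exact: filtD.
rewrite sumrB; set S := \sum_(i <- s) kappa i in VKk *.
set SG := \sum_(i <- s) G i => VS'.
have -> : SG = K - (K - S) - (S - SG) by ring.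
by apply: VB VS'; apply: VB.
Qed.

End Linearization.

(** * Rays and their order *)

(** The primitive vectors of the open first quadrant, together with (0, 1). *)
Definition ray v := [&& 0 <= v.1, 0 < v.2 & coprimez v.1 v.2].

(** The inverse slope, which stays finite on (0, 1). *)
Definition recip (v : int * int) : rat := v.1%:~R / v.2%:~R.

(** Comparison of rays by decreasing slope. *)
Definition ray_lt v w := recip v < recip w.

Lemma ray_first_quadrant v :
  first_quadrant_primitive v = ray v && (v != (0, 1)).
Proof.
case: v => a b; rewrite /first_quadrant_primitive /ray /= xpair_eqE.
have [b0|] /= := boolP (0 < b); last by rewrite !andbF.
have [->|a0] := eqVneq a 0; last by rewrite lt_def a0 andbT.
rewrite /coprimez gcd0z /= -[LHS]/false; apply/esym/negbTE.
by rewrite negb_and negbK; case: eqP => //; lia.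
Qed.

Lemma ray_inj v w : ray v -> ray w -> v.1 * w.2 = w.1 * v.2 -> v = w.
Proof.
case: v w => [a b] [c d] /and3P /= [a0 b0 ab] /and3P /= [c0 d0 cd] e.
have bd : (b %| d)%Z.
  by rewrite -(@Gauss_dvdzr _ a) 1?coprimez_sym // e dvdz_mull.
have db : (d %| b)%Z.
  by rewrite -(@Gauss_dvdzr _ c) 1?coprimez_sym // -e dvdz_mull.
have bdE : b = d.
  have /eqP : (`|b| == `|d|)%N by rewrite eqn_dvd; apply/andP; split.
  lia.
by rewrite bdE in e b0 *; congr pair; apply: (mulIf (lt0r_neq0 b0)).
Qed.

Lemma recip_inj v w : ray v -> ray w -> recip v = recip w -> v = w.
Proof.
move=> rv rw e; apply: ray_inj => //; move: rv rw => /and3P[_ v0 _] /and3P[_ w0 _].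
have vQ : v.2%:~R != 0 :> rat by rewrite intr_eq0 lt0r_neq0.
have wQ : w.2%:~R != 0 :> rat by rewrite intr_eq0 lt0r_neq0.
apply: (@intr_inj rat); rewrite !intrM; apply/eqP.
by rewrite -eqr_div //; apply/eqP.
Qed.

Lemma slope_ray v w : 0 < v.1 -> 0 < v.2 -> 0 < w.1 -> 0 < w.2 ->
  (slope w < slope v) = ray_lt v w.
Proof.
move=> v1 v2 w1 w2; rewrite /slope /ray_lt /recip.
rewrite !ltr_pdivrMr ?ltr0z // mulrAC ltr_pdivlMr ?ltr0z //.
rewrite [X in _ = (_ < X)]mulrAC ltr_pdivlMr ?ltr0z //.
by rewrite mulrC [X in (_ < X) = _]mulrC.
Qed.

Definition sort_rays (s : seq (int * int)) :=
  sort (relpre recip <=%O) (undup s).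

Lemma mem_sort_rays s : sort_rays s =i s.
Proof. by move=> v; rewrite mem_sort mem_undup. Qed.

Lemma sorted_sort_rays s : all ray s -> sorted ray_lt (sort_rays s).
Proof.
move=> rs; have -> : ray_lt = relpre recip <%O by [].
rewrite -sorted_map lt_sorted_uniq_le sorted_map sort_sorted ?andbT; last first.
  by move=> v w; apply: le_total.
rewrite map_inj_in_uniq ?sort_uniq ?undup_uniq // => v w.
by rewrite !mem_sort_rays => /(allP rs) rv /(allP rs) rw; apply: recip_inj.
Qed.

Lemma ray_lt_trans : transitive ray_lt.
Proof. by move=> v u w; apply: lt_trans. Qed.

Lemma ray_lt_irr : irreflexive ray_lt.
Proof. by move=> v; apply: ltxx. Qed.

(** * Ordered products over rays *)

Section Products.
Variable C : comNzRingType.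
Implicit Types (u f g : tvring C) (v w : int * int) (s : seq (int * int)).

Lemma eqt_refl k u : eqt k u u. Proof. by []. Qed.

Section Compose.
Variables (F : int * int -> tvring C) (th : int * int -> tvaut C).
Hypothesis actsF : forall v, ray v -> acts v (F v) (th v).

Lemma tvcompose_filter k (a : pred (int * int)) s : all ray s ->
    {in s, forall v, ~~ a v -> eq_mod_t k (th v) id} ->
  eq_mod_t k (tvcompose th s) (tvcompose th (filter a s)).
Proof.
elim: s => //= v s IHs /andP[rv rs] triv u.
have {}IHs : eqt k (tvcompose th s u) (tvcompose th (filter a s) u).
  by apply: IHs => // w ws; apply: triv; rewrite inE ws orbT.
case: ifP => av /=; first exact: acts_eqt (actsF rv) IHs.
by apply: eqt_trans IHs; apply: triv; rewrite ?mem_head ?av.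
Qed.

Lemma tvcompose_rcons s v u :
  tvcompose th (rcons s v) u = tvcompose th s (th v u).
Proof. by elim: s => //= w s ->. Qed.

(** The image of x under a product, divided by x, is the composite to which
    [filt_foldr] applies. *)
Lemma tvcompose_x s : all ray s ->
  tvcompose th s (tvx C) =
  tvx C * foldr (fun v u => F v ^ (- v.2) * th v u) 1 s.
Proof.
elim: s => [|v s IHs] /=; first by rewrite mulr1.
move=> /andP[rv rs]; rewrite IHs // rmorphM.
have [_ thx _] := actsF rv; apply: etrans (esym (mulrA _ _ _)).
exact: (congr1 (fun z => z * th v _) thx).
Qed.

End Compose.

(** S maps 1 + t y to this series W. *)
Definition wallS (l : nat) : tvring C :=
  1 + tvt C * tvy C * (1 + tvt C * tvx C) ^+ l.

(** U is the ordered product, over all rays v, of automorphisms th v of wall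
    function F v, and acts on x as S T S^-1 does; U' is its inverse, of which
    only the cancellation on one side is needed. *)
Record ray_product (l1 l2 : nat) (F : int * int -> tvring C)
    (th : int * int -> tvaut C) (U U' : tvring C -> tvring C) : Prop :=
  RayProduct {
  rp_ray : forall v, ray v -> on_ray v (F v);
  rp_acts : forall v, ray v -> acts v (F v) (th v);
  rp_K : cancel U' U;
  rp_x : U (tvx C) = tvx C * wallS l1 ^ (- (l2 : int));
  rp_x' : U' (tvx C) = tvx C * wallS l1 ^ (l2 : int);
  rp_prod : forall k, exists s, [/\ all ray s, sorted ray_lt s,
    forall v, ray v -> v \notin s -> eq_mod_t k (th v) id
    & eq_mod_t k U (tvcompose th s)]
}.

(** Modulo t^k, the product may be taken over any sorted list of rays that
    contains the nontrivial ones among finitely many given rays. *)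
Lemma ray_product_list l1 l2 F th U U' k : ray_product l1 l2 F th U U' ->
  exists2 s0, all ray s0 & forall s, all ray s -> sorted ray_lt s ->
    {in s0, forall v, v \notin s -> F v = 1} ->
    eq_mod_t k U (tvcompose th s).
Proof.
move=> rp; have [s0 [rs0 ss0 triv Us0]] := rp_prod rp k; exists s0 => // s rs ss s0s u.
have acF := rp_acts rp.
have sE : filter [in s] s0 = filter [in s0] s.
  apply: (irr_sorted_eq ray_lt_trans ray_lt_irr).
  - exact: sorted_filter ray_lt_trans _ _ ss0.
  - exact: sorted_filter ray_lt_trans _ _ ss.
  by move=> v; rewrite !mem_filter andbC.
apply: eqt_trans (Us0 u) _.
apply: (@eqt_trans _ _ _ (tvcompose th (filter [in s] s0) u)).
  apply: (tvcompose_filter acF) => // v vs0 vs u' n _.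
  have := acF v (allP rs0 v vs0); rewrite s0s //.
  by move=> /acts1 ->.
rewrite sE; apply: eqt_sym; apply: (tvcompose_filter acF) => // v vs vs0.
exact: triv (allP rs v vs) vs0.
Qed.

Lemma eqt_mulKl k f u g : f \is a GRing.unit ->
  eqt k (f * u) (f * g) -> eqt k u g.
Proof.
move=> fU fug n nk; rewrite -[u](mulKr fU) -[g](mulKr fU).
exact: eqtM (@eqt_refl k f^-1) fug _ nk.
Qed.

Lemma eqt_tvx k u f : eqt k (tvx C * u) (tvx C * f) -> eqt k u f.
Proof. by apply: eqt_mulKl; apply: tvmon_unit. Qed.

End Products.

Section Wall.
Variable C : comNzRingType.
Implicit Types (u f : tvring C) (v w : int * int).

Lemma tcf_tM0 v u : tcf 0 v (tvt C * u) = 0.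
Proof. by rewrite /tcf tcoef_tM0 raddf0. Qed.

Lemma tcf_tMS n v u : tcf n.+1 v (tvt C * u) = tcf n v u.
Proof. by rewrite /tcf tcoef_tMS. Qed.

Lemma tcf_monM n v w u : tcf n v (tvmon C w * u) = tcf n (v - w) u.
Proof. by rewrite /tcf tcoef_constM lcoef_monM mul1r. Qed.

Lemma tcf_1txX l n v :
  tcf n v ((1 + tvt C * tvx C) ^+ l) = 'C(l, n)%:R *+ (v == (n : int, 0)).
Proof.
elim: l n v => [|l IHl] n v.
  rewrite expr0 tcf1 bin0n; case: n => [|n] /=; last by rewrite mul0rn.
  by rewrite -[v == (0%N : int, 0)]/(v == 0); case: (v == 0).
rewrite exprS; set P := _ ^+ l in IHl *.
have -> : (1 + tvt C * tvx C) * P = P + tvt C * (tvx C * P).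
  have aux (R : comNzRingType) (a b c : R) : (1 + a * b) * c = c + a * (b * c).
    by ring.
  exact: aux.
rewrite raddfD /= IHl; case: n => [|n].
  by rewrite tcf_tM0 addr0 !bin0.
rewrite tcf_tMS tcf_monM IHl binS natrD mulrnDl; congr (_ + _ *+ _).
by case: v => i j; rewrite subr_eq !xpair_eqE /= addr0 intS addrC.
Qed.

Lemma tcf_wallS l n v : tcf n v (wallS C l - 1) =
  'C(l, n.-1)%:R *+ ((0 < n)%N && (v == (n.-1 : int, 1))).
Proof.
have -> : wallS C l - 1 = tvt C * (tvy C * (1 + tvt C * tvx C) ^+ l).
  have aux (R : comNzRingType) (a b c : R) : 1 + a * b * c - 1 = a * (b * c).
    by ring.
  exact: aux.
case: n => [|n]; first by rewrite tcf_tM0 mulr0n.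
rewrite tcf_tMS tcf_monM tcf_1txX subr_eq; congr (_ *+ _).
by case: v => i j; rewrite !xpair_eqE /= addr0 add0r.
Qed.

Lemma tcoef0_wallS l : tcoef (wallS C l) 0 = 1.
Proof.
apply: lcoefP => v; have := tcf_wallS l 0 v.
by rewrite mulr0n raddfB => /eqP; rewrite subr_eq0 => /eqP.
Qed.

End Wall.

(** * Supports of the wall functions *)

Lemma ray_multiple_inj v w k k' :
  ray v -> ray w -> v *+ k.+1 = w *+ k'.+1 -> v = w.
Proof.
move=> rv rw e.
have e1 : v.1 * k.+1%:R = w.1 * k'.+1%:R.
  by rewrite !mulr_natr -!raddfMn e.
have e2 : v.2 * k.+1%:R = w.2 * k'.+1%:R.
  by rewrite !mulr_natr -!raddfMn e.
apply: ray_inj => //.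
suff: v.1 * w.2 * k'.+1%:R = w.1 * v.2 * k'.+1%:R by apply: mulIf; rewrite pnatr_eq0.
by rewrite -mulrA -e2 mulrCA e1; ring.
Qed.

Section Twist.
Variable C : comNzRingType.
Implicit Types (u f g : tvring C) (v w : int * int).

Lemma mul_neq0 (a b : C) : a * b != 0 -> a != 0 /\ b != 0.
Proof.
by move=> ab; split; apply: contraNneq ab => ->; rewrite ?mul0r ?mulr0.
Qed.

(** A nonzero coefficient of a twisted convolution comes from nonzero
    coefficients of its two ingredients. *)
Lemma twist_neq0 u (g : int * int -> tvring C) n v : twist u g n v != 0 ->
  exists m w, [/\ (m <= n)%N, tcf m w u != 0 & tcf (n - m) (v - w) (g w) != 0].
Proof.
move=> tw0; apply: contrapT => no; case/eqP: tw0.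
rewrite /twist big1 // => m _; rewrite big1 // => w _.
apply: contrapT => /eqP /mul_neq0[mw gw]; apply: no.
by exists m, w; split=> //; rewrite -ltnS.
Qed.

Lemma tcfB n v u f : tcf n v (u - f) = tcf n v u - tcf n v f.
Proof. exact: raddfB. Qed.

Lemma tcf_actsB v f (phi : tvaut C) u n w : acts v f phi ->
  tcf n w (phi u - u) = twist u (fun w' => f ^ det v w' - 1) n w.
Proof.
move=> aphi; rewrite tcfB (tcf_acts _ _ _ aphi) -[X in _ - X]tcf_twist1 -sumrB.
apply: eq_bigr => m _; rewrite -sumrB; apply: eq_bigr => w' _.
by rewrite tcfB mulrBr.
Qed.

Lemma tcf_0 n v u : tcoef u 0 = 0 -> tcf n v u != 0 -> (0 < n)%N.
Proof. by move=> u0; case: n => //; rewrite /tcf u0 raddf0 eqxx. Qed.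

Lemma tcf_sumMz n z s (G : int * int -> tvring C) (a : int * int -> int) :
  tcf n z (\sum_(w <- s) G w *~ a w) = \sum_(w <- s) tcf n z (G w) *~ a w.
Proof. by rewrite raddf_sum; apply: eq_bigr => w _; exact: raddfMz. Qed.

(** In a sum over distinct rays of series supported on them, the coefficient at
    a multiple of the ray v comes from the term of v alone. *)
Lemma tcf_sum_ray n y z v k s (G : int * int -> tvring C)
    (a : int * int -> int) :
    all ray s -> uniq s -> v \in s -> z = v *+ k.+1 ->
    {in s, forall w, tcf n y (G w) != 0 -> exists k', z = w *+ k'.+1} ->
  tcf n y (\sum_(w <- s) G w *~ a w) = tcf n y (G v) *~ a v.
Proof.
move=> rs us vs zE supp; rewrite tcf_sumMz (bigD1_seq v) //.
rewrite big_seq_cond big1; first exact: addr0.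
move=> w /andP[ws wv]; have [->|/(supp w ws)[k' zE']] := eqVneq (tcf n y (G w)) 0.
  exact: mul0rz.
have wvE : w = v.
  apply: (ray_multiple_inj (k := k') (k' := k) (allP rs w ws) (allP rs v vs)).
  by rewrite -zE -zE'.
by rewrite wvE eqxx in wv.
Qed.

End Twist.

Section Support.
Variable C : numDomainType.
Variables (l1 l2 : nat) (F : int * int -> tvring C) (th : int * int -> tvaut C).
Variables (U U' : tvring C -> tvring C).
Hypothesis rp : ray_product l1 l2 F th U U'.
Implicit Types (u f g : tvring C) (v w : int * int).

(** The monomials t^n x^i y^j with n = i + j and 0 <= i <= l1 * j. *)
Definition cone n v :=
  [&& 0 <= v.1, v.1 <= l1%:Z * v.2 & n%:Z == v.1 + v.2].

Lemma coneD m n v w : cone m v -> cone n w -> cone (m + n) (v + w).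
Proof.
case: v w => [i j] [i' j']; rewrite /cone /=.
by move=> /and3P[a b /eqP c] /and3P[a' b' /eqP c']; apply/and3P; split; lia.
Qed.

(** The constant term in t vanishes. *)
Definition red0 u := tcoef u 0 = 0.

(** Below t^n, only monomials of the cone occur. *)
Definition cone_upto n u :=
  forall m v, (m < n)%N -> tcf m v u != 0 -> cone m v.

Lemma filtered_cone : filtered red0 cone_upto.
Proof.
split=> //.
- by move=> u f u0 f0; rewrite /red0 tcoefB u0 f0 subrr.
- by move=> u f u0 f0; rewrite /red0 tcoef0M u0 mul0r.
- by move=> n m v _; rewrite raddf0 eqxx.
- move=> n u f Vu Vf m v mn; have [u0|/Vu-> //] := eqVneq (tcf m v u) 0.
  by rewrite tcfB u0 sub0r oppr_eq0; apply: Vf.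
- by move=> n u Vu m v mn; apply: Vu; apply: ltnW.
- by move=> u u0 m v m1 /(tcf_0 u0); case: m m1.
move=> n u f n0 u0 f0 Vu Vf m v mn; rewrite tcfM.
move=> /twist_neq0[i [w [im uw fw]]].
have i0 := tcf_0 u0 uw; have mi0 := tcf_0 f0 fw.
rewrite -(subnKC im) -(subrK w v) addrC; apply: coneD.
  by apply: Vu uw; lia.
by apply: Vf fw; lia.
Qed.

Lemma cone_wallS n : cone_upto n (wallS C l1 - 1).
Proof.
move=> m v mn; rewrite tcf_wallS.
case: andP => [[m0 /eqP ->]|]; last by rewrite eqxx.
move=> bin0.
have ml : (m.-1 <= l1)%N.
  by rewrite -ltnS -(prednK m0) ltnS leqNgt; apply: contra bin0 => /bin_small ->.
by apply/and3P; split=> /=; lia.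
Qed.

Lemma red0_expz f (z : int) : tcoef f 0 = 1 -> red0 (f ^ z - 1).
Proof. by move=> f1; rewrite /red0 tcoefB tcoef0Xz // subrr. Qed.

Lemma cone_expz n f (z : int) : tcoef f 0 = 1 -> (0 < n)%N ->
    cone_upto n (f - 1) ->
  cone_upto n (f ^ z - 1) /\ cone_upto n.+1 (f ^ z - 1 - (f - 1) *~ z).
Proof.
move=> f1 n0 Vf; rewrite -{2}[f]expr1z.
apply: (filt_expz filtered_cone (E := fun z => f ^ z) (n := n)) => //.
- by move=> y; rewrite exprzDr // tvunit.
- by move=> y; apply: red0_expz.
Qed.

Lemma rmorph_sub1 (R : nzRingType) (phi : {rmorphism R -> R}) (u : R) :
  phi u - u = phi (u - 1) - (u - 1).
Proof. by rewrite rmorphB rmorph1 opprB addrA subrK. Qed.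

Lemma red0_acts v f (phi : tvaut C) u : acts v f phi ->
  red0 (u - 1) -> red0 (phi u - 1).
Proof.
move=> aphi u0; have -> : phi u - 1 = phi (u - 1) by rewrite rmorphB rmorph1.
have u1 : eqt 1 (u - 1) 0 by case=> // _; apply: u0.
by rewrite /red0 (acts_eqt aphi u1) // rmorph0.
Qed.

Lemma cone_acts n v f (phi : tvaut C) u : acts v f phi -> (0 < n)%N ->
    cone_upto n (f - 1) -> red0 (u - 1) -> cone_upto n (u - 1) ->
  red0 (phi u - 1) /\ cone_upto n.+1 (phi u - u).
Proof.
move=> aphi n0 Vf u0 Vu; have f1 : tcoef f 0 = 1 by case: aphi.
have Vphi : cone_upto n.+1 (phi u - u).
  rewrite (rmorph_sub1 phi).
  move=> m w mn; rewrite (tcf_actsB _ _ _ aphi) => /twist_neq0[i [w' [im uw fw]]].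
  have i0 := tcf_0 u0 uw; have mi0 := tcf_0 (red0_expz _ f1) fw.
  rewrite -(subnKC im) -(subrK w' w) addrC; apply: coneD.
    by apply: Vu uw; lia.
  by have [Vfz _] := cone_expz (det v w') f1 n0 Vf; apply: Vfz fw; lia.
by split=> //; apply: red0_acts aphi u0.
Qed.

Lemma foldr_wallS k s : all ray s -> eqt k (U (tvx C)) (tvcompose th s (tvx C)) ->
  eqt k (foldr (fun v u => F v ^ (- v.2) * th v u) 1 s)
        (wallS C l1 ^ (- (l2 : int))).
Proof.
move=> rs; rewrite (rp_x rp) (tvcompose_x (rp_acts rp) rs) => /eqt_sym.
exact: eqt_tvx.
Qed.

Lemma ray_supp n z v : ray v ->
  tcf n z (F v - 1) != 0 -> exists k, z = v *+ k.+1.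
Proof.
move=> rv; have [f1 _ _] := rp_acts rp rv.
have c1 : tcf n z (F v - 1) = tcf n z (F v) - tcf n z 1 by exact: tcfB.
have [/eqP|vz] := eqVneq (tcf n z (F v)) 0.
  rewrite c1 tcf1; case: andP => [[/eqP-> /eqP->]|_ /eqP->]; last first.
    by rewrite subrr eqxx.
  by rewrite /tcf f1 lcoef1 eqxx oner_eq0.
have [[n0 z0]|[_ [k zE]] _] := rp_ray rp rv vz; last by exists k.
by rewrite c1 n0 z0 tcf1 /tcf f1 lcoef1 !eqxx subrr eqxx.
Qed.

(** One step of the induction on the order in t: both the image of x under the
    product and the nonlinear contributions of the factors are supported on the
    cone at order n, hence so is each wall function. *)
Lemma cone_step n : (0 < n)%N ->
    (forall v, ray v -> cone_upto n (F v - 1)) ->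
  forall v, ray v -> cone_upto n.+1 (F v - 1).
Proof.
move=> n0 IH v rv.
have [s0 rs0 Us0] := ray_product_list n.+1 rp.
pose s := sort_rays (v :: s0).
have rs : all ray s.
  apply/allP => w; rewrite mem_sort_rays inE => /predU1P[-> //|].
  exact: (allP rs0).
have ss : sorted ray_lt s by apply: sorted_sort_rays; rewrite /= rv.
have vs : v \in s by rewrite mem_sort_rays mem_head.
have KD : eqt n.+1 (foldr (fun w u => F w ^ (- w.2) * th w u) 1 s)
                   (wallS C l1 ^ (- (l2 : int))).
  apply: (foldr_wallS rs); apply: Us0 => // w ws0.
  by rewrite mem_sort_rays inE ws0 orbT.
have f1 w : ray w -> tcoef (F w) 0 = 1 by case/(rp_acts rp).
have [||_ _] := filt_foldr filtered_cone (s := s) (kappa := fun w => F w ^ (- w.2))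
  (Theta := fun w => th w) n0.
- move=> w /(allP rs) rw; split; first exact: red0_expz (f1 w rw).
  by have [] := cone_expz (- w.2) (f1 w rw) n0 (IH w rw).
- move=> w /(allP rs) rw u u0 Vu.
  exact: cone_acts (rp_acts rp rw) n0 (IH w rw) u0 Vu.
set K := foldr _ _ _ in KD *.
have VK : cone_upto n.+1 (K - 1).
  move=> m w mn; rewrite tcfB {1}/tcf KD // -/(tcf m w _) -tcfB.
  by have [+ _] := cone_expz (n := n.+1) (- (l2 : int)) (tcoef0_wallS C l1) isT
    (@cone_wallS n.+1); apply.
move=> VKS m z mn vz.
have {}VKS : cone_upto n.+1 (\sum_(w <- s) (F w - 1) *~ (- w.2)).
  apply: (filt_sum filtered_cone VK VKS) => w /(allP rs) rw.
  by have [] := cone_expz (- w.2) (f1 w rw) n0 (IH w rw).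
apply: VKS => //; have [k zE] := ray_supp rv vz.
rewrite (tcf_sum_ray _ rs _ vs zE) ?sort_uniq ?undup_uniq //; last first.
  by move=> w /(allP rs) rw; apply: ray_supp.
by rewrite mulrz_eq0 negb_or vz andbT oppr_eq0; case/and3P: rv => _ /lt0r_neq0.
Qed.

Lemma cone_ray v n z : ray v -> tcf n z (F v - 1) != 0 -> cone n z.
Proof.
move=> rv; suff /(_ n.+1 isT v rv) : forall n, (0 < n)%N ->
    forall v, ray v -> cone_upto n (F v - 1) by apply.
elim=> // -[|k] IHk _; last exact: cone_step (IHk isT).
move=> w rw; apply: (filt1 filtered_cone).
by have [f1 _ _] := rp_acts rp rw; apply: (red0_expz 1 f1).
Qed.

End Support.

(** * The involution on homogeneous series *)

Section Homogeneous.
Variable C : numDomainType.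
Variable l : nat.
Hypothesis l0 : (0 < l)%N.
Implicit Types (u f g : tvring C) (v w : int * int).

(** The involution sigma of the exponents. *)
Definition refl v : int * int := (l%:Z * v.2 - v.1, v.2).

Lemma reflK : involutive refl.
Proof. by case=> i j; rewrite /refl /= subKr. Qed.

Lemma reflB v w : refl v - refl w = refl (v - w).
Proof. by case: v w => [i j] [i' j']; congr pair; rewrite /=; ring. Qed.

Lemma det_refl v w : det (refl v) (refl w) = - det v w.
Proof. by rewrite /det /refl /=; ring. Qed.

(** The exponent of t that accompanies the exponent v in the cone. *)
Definition tdeg v : nat := absz (v.1 + v.2).

(** Membership of v in the cone, for the exponent of t that fits. *)
Definition in_cone v := cone l (tdeg v) v.

Lemma in_coneE v : in_cone v = (0 <= v.1) && (v.1 <= l%:Z * v.2).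
Proof.
rewrite /in_cone /cone /tdeg andbA; apply: andb_idr => /andP[v1 v12].
have v2 : 0 <= v.2 by rewrite -(@pmulr_rge0 _ l%:Z) //; apply: le_trans v12.
by rewrite gez0_abs // addr_ge0.
Qed.

Lemma in_cone_refl v : in_cone (refl v) = in_cone v.
Proof. by rewrite !in_coneE /refl /= subr_ge0 andbC gerBl. Qed.

Lemma cone_tdeg n v : cone l n v -> n = tdeg v.
Proof. by rewrite /cone /tdeg => /and3P[_ _ /eqP <-]. Qed.

Lemma tdegB v w : in_cone v -> in_cone w -> (tdeg w <= tdeg v)%N ->
  (tdeg v - tdeg w)%N = tdeg (v - w).
Proof.
rewrite /in_cone /cone /tdeg; case: v w => [i j] [i' j'] /=.
by move=> /and3P[? ? /eqP ?] /and3P[? ? /eqP ?]; lia.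
Qed.

Lemma tdeg_leq v w : in_cone v -> in_cone w -> in_cone (v - w) ->
  (tdeg w <= tdeg v)%N.
Proof.
rewrite /in_cone /cone /tdeg; case: v w => [i j] [i' j'] /=.
by move=> /and3P[? ? /eqP ?] /and3P[? ? /eqP ?] /and3P[? ? /eqP ?]; lia.
Qed.

(** Series supported on the cone.  Such a series is determined by its
    coefficients [hc]. *)
Definition hom u := forall n, cone_upto l n u.

(** The coefficient at v of a series supported on the cone. *)
Definition hc v u : C := tcf (tdeg v) v u.

Lemma hom_cone n v u : hom u -> tcf n v u != 0 -> cone l n v.
Proof. by move=> hu; apply: hu (ltnSn n). Qed.

Lemma hc_out v u : hom u -> ~~ in_cone v -> hc v u = 0.
Proof. by move=> hu; apply: contraNeq => /(hom_cone hu). Qed.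

Lemma homE n v u : hom u -> tcf n v u = hc v u *+ cone l n v.
Proof.
move=> hu; have [vu|] := boolP (cone l n v).
  by rewrite mulr1n (cone_tdeg vu).
by apply: contraNeq => /(hom_cone hu).
Qed.

Lemma homB u f : hom u -> hom f -> hom (u - f).
Proof. by move=> hu hf n; apply: (filtB (filtered_cone C l)). Qed.

Lemma hom_expz f z : tcoef f 0 = 1 -> hom (f - 1) -> hom (f ^ z - 1).
Proof.
move=> f1 hf [|n] //; by have [] := cone_expz z f1 (ltn0Sn n) (hf n.+1).
Qed.

Lemma hom_twist u (g : int * int -> tvring C) n v :
  hom u -> (forall w, hom (g w)) -> twist u g n v != 0 -> cone l n v.
Proof.
move=> hu hg /twist_neq0[m [w [mn uw gw]]].
rewrite -(subnKC mn) -(subrK w v) addrC; apply: coneD.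
  exact: hom_cone uw.
exact: hom_cone gw.
Qed.

(** For series supported on the cone, the index of t is redundant and a twisted
    convolution becomes a sum over exponents only, here over any list r
    that is large enough. *)
Lemma twist_hc r u (g : int * int -> tvring C) v :
    hom u -> (forall w, hom (g w)) -> uniq r ->
    (forall m w, (m <= tdeg v)%N -> w \in msupp (tcoef u m) -> w \in r) ->
    in_cone v ->
  twist u g (tdeg v) v = \sum_(w <- r) hc w u * hc (v - w) (g w).
Proof.
move=> hu hg ur supp vC.
transitivity (\sum_(m < (tdeg v).+1) \sum_(w <- r)
    tcf m w u * tcf (tdeg v - m) (v - w) (g w)).
  apply: eq_bigr => m _; rewrite [RHS](bigID [in msupp (tcoef u m)]) /=.
  rewrite [X in _ = _ + X]big1 ?addr0; last first.
    by move=> w wm; rewrite {1}/tcf (lcoef_supp wm) mul0r.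
  rewrite -[RHS]big_filter; apply: perm_big; apply: uniq_perm.
  - exact: fset_uniq.
  - exact: filter_uniq.
  move=> w; rewrite mem_filter andbC; case: (boolP (w \in msupp _)) => [wm|_].
    by rewrite (supp m) // -ltnS.
  by rewrite andbF.
rewrite exchange_big; apply: eq_bigr => w _ /=.
have [uw0|uw0] := eqVneq (hc w u) 0.
  by rewrite uw0 mul0r big1 // => m _; rewrite (homE _ _ hu) uw0 mul0rn mul0r.
have wC := hom_cone hu uw0.
have [wv|wv] := leqP (tdeg w) (tdeg v).
  rewrite (bigD1 (Ordinal (wv : (tdeg w < (tdeg v).+1)%N))) //= big1 ?addr0.
    by rewrite /hc tdegB.
  move=> m mw; rewrite (homE _ _ hu).
  case: (boolP (cone l m w)) => [/cone_tdeg mE|]; last by rewrite mul0r.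
  by case/eqP: mw; apply: val_inj.
rewrite big1 => [|m _].
  apply/esym/eqP; rewrite mulf_eq0; apply/orP; right; apply: contraTT wv.
  by move=> /(hom_cone (hg w)) vwC; rewrite -leqNgt; apply: tdeg_leq.
rewrite (homE _ _ hu).
case: (boolP (cone l m w)) => [/cone_tdeg mE|]; last by rewrite mul0r.
by move: (ltn_ord m); rewrite mE ltnS leqNgt wv.
Qed.

End Homogeneous.

Section Matching.
Variable C : numDomainType.
Variable l : nat.
Hypothesis l0 : (0 < l)%N.
Implicit Types (u f g : tvring C) (v w : int * int).

Notation hom := (hom (C := C) l).
Notation in_cone := (in_cone l).
Notation refl := (refl l).

(** Up to the degree N in y, excluded, the coefficients of f are those of u
    moved by the involution. *)
Definition matched N u f :=
  forall v, in_cone v -> v.2 < N%:Z -> hc v u = hc (refl v) f.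

Lemma hc_red0 u v : hom u -> red0 u -> hc v u != 0 -> 0 < v.2.
Proof.
move=> hu u0 uv; have := hom_cone hu uv; rewrite -/(in_cone v) in_coneE //.
move=> /andP[v1 v12]; rewrite lt_neqAle; apply/andP; split.
  apply: contraNneq uv => v2; rewrite /hc.
  suff -> : tdeg v = 0%N by rewrite /tcf u0 raddf0.
  by move: v1 v12; rewrite /tdeg -v2 mulr0 => ? ?; lia.
by rewrite -(@pmulr_rge0 _ l%:Z) //; apply: le_trans v12.
Qed.

(** Twisted convolutions of matched series are matched one degree further, as
    in each product of coefficients both factors have positive degree in y. *)
Lemma twist_matched N u u' (g g' : int * int -> tvring C) v :
    hom u -> hom u' -> red0 u -> red0 u' -> matched N u u' ->
    (forall w, [/\ hom (g w), hom (g' w), red0 (g w), red0 (g' w)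
      & matched N (g w) (g' w)]) ->
    in_cone v -> v.2 < N.+1%:Z ->
  twist u g (tdeg v) v =
  twist u' (fun w => g' (refl w)) (tdeg (refl v)) (refl v).
Proof.
move=> hu hu' u0 u0' muu hg vC vN.
pose S (f : tvring C) n :=
  flatten [seq enum_fset (msupp (tcoef f m)) | m <- iota 0 n.+1].
have SP f n m w : (m <= n)%N -> w \in msupp (tcoef f m) -> w \in S f n.
  move=> mn wm; apply/flatten_mapP; exists m => //.
  by rewrite mem_iota.
pose r := undup (S u (tdeg v) ++ map refl (S u' (tdeg (refl v)))).
have refl_inj : injective refl by apply: can_inj (@reflK l).
rewrite (twist_hc l0 (r := r)) ?undup_uniq //; first last.
- by move=> m w mn wm; rewrite mem_undup mem_cat (SP _ _ _ _ mn wm).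
- by move=> w; case: (hg w).
rewrite (twist_hc l0 (r := map refl r)) //; first last.
- by rewrite in_cone_refl.
- move=> m w mn wm; rewrite -(reflK l w) mem_map // mem_undup mem_cat.
  by rewrite mem_map // (SP _ _ _ _ mn wm) orbT.
- by rewrite map_inj_uniq // undup_uniq.
- by move=> w; case: (hg (refl w)).
rewrite big_map; apply: eq_bigr => w _; rewrite reflK reflB.
have [hgw hgw' gw0 gw0' mgg] := hg w.
have small : 0 < w.2 -> 0 < (v - w).2 ->
    hc w u * hc (v - w) (g w) = hc (refl w) u' * hc (refl (v - w)) (g' w).
  move=> w2 vw2; have [wC|wC] := boolP (in_cone w); last first.
    by rewrite !(hc_out _ wC) // (hc_out hu') ?in_cone_refl // !mul0r.
  have [vwC|vwC] := boolP (in_cone (v - w)); last first.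
    by rewrite !(hc_out _ vwC) // (hc_out hgw') ?in_cone_refl // !mulr0.
  by rewrite muu ?mgg //; move: w2 vw2 vN; rewrite /=; lia.
have [wu|wu] := eqVneq (hc w u * hc (v - w) (g w)) 0.
  have [//|wu'] := eqVneq (hc (refl w) u' * hc (refl (v - w)) (g' w)) 0.
    by rewrite wu => ->.
  have [/(hc_red0 hu' u0') w2 /(hc_red0 hgw' gw0') vw2] := mul_neq0 wu'.
  exact: small.
have [/(hc_red0 hu u0) w2 /(hc_red0 hgw gw0) vw2] := mul_neq0 wu.
exact: small.
Qed.

(** Pairs of series on the cone without constant term: the ambient ring of the
    second induction is a product of two rings, a series and its mirror image. *)
Definition red_pair (p : tvring C * tvring C) :=
  [/\ hom p.1, hom p.2, red0 p.1 & red0 p.2].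

Definition matched_pair N (p : tvring C * tvring C) := matched N p.1 p.2.

Lemma hcB v u f : hc v (u - f) = hc v u - hc v f.
Proof. exact: tcfB. Qed.

Lemma homM u f : hom u -> hom f -> hom (u * f).
Proof.
move=> hu hf n m v _; rewrite tcfM; exact: hom_twist.
Qed.

Lemma filtered_matched : filtered red_pair matched_pair.
Proof.
have I0 := filtI0 (filtered_cone C l); have IB := filtIB (filtered_cone C l).
have IM := filtIM (filtered_cone C l).
have h0 : hom 0 by move=> n; apply: filt0 (filtered_cone C l) _.
split.
- by split.
- move=> [u f] [u' f'] [/= ? ? ? ?] [/= ? ? ? ?].
  by split; [apply: homB|apply: homB|apply: IB|apply: IB].
- move=> [u f] [u' f'] [/= ? ? ? ?] [/= ? ? ? ?].
  by split; [apply: homM|apply: homM|apply: IM|apply: IM].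
- by move=> n v _ _; rewrite /hc !raddf0.
- move=> n [u f] [u' f'] muf muf' v vC vn.
  by rewrite hcB (muf v) // (muf' v) // -hcB.
- by move=> n p mp v vC vn; apply: mp => //; apply: lt_trans vn _; rewrite ltz_nat.
- move=> [u f] [/= hu hf u0 f0] v vC v1.
  have [uv|/(hc_red0 hu u0)] := eqVneq (hc v u) 0; last by lia.
  have [fv|/(hc_red0 hf f0)] := eqVneq (hc (refl v) f) 0; first by rewrite uv fv.
  by rewrite /=; lia.
move=> n [u f] [u' f'] n0 [/= hu hf u0 f0] [/= hu' hf' u0' f0'] muf muf' v vC vn.
rewrite /hc !tcfM.
exact: (twist_matched (g := fun=> u') (g' := fun=> f') hu hf u0 f0 muf).
Qed.

End Matching.

Lemma foldr_pair (R : nzRingType) (T : Type) (s : seq T) (Th Th' : T -> R -> R)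
    (k k' : T -> R) :
  foldr (fun i (p : R * R) => (k i, k' i) * (Th i p.1, Th' i p.2)) 1 s =
  (foldr (fun i u => k i * Th i u) 1 s, foldr (fun i u => k' i * Th' i u) 1 s).
Proof. by elim: s => //= i s ->. Qed.

Section MatchedPairs.
Variable C : numDomainType.
Variable l : nat.
Hypothesis l0 : (0 < l)%N.
Implicit Types (u f g : tvring C) (v w : int * int).

Notation hom := (hom (C := C) l).
Notation refl := (refl l).
Notation matched := (matched (C := C) l).

Lemma pair_Mz (A B : zmodType) (a : A) (b : B) (z : int) :
  (a, b) *~ z = (a *~ z, b *~ z).
Proof. by rewrite [LHS]surjective_pairing !raddfMz. Qed.

Lemma pair_sumMz (A B : zmodType) (T : Type) (s : seq T) (a : T -> A)
    (b : T -> B) (c : T -> int) :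
  \sum_(i <- s) (a i, b i) *~ c i =
  (\sum_(i <- s) a i *~ c i, \sum_(i <- s) b i *~ c i).
Proof.
elim: s => [|i s IHs]; first by rewrite !big_nil.
by rewrite !big_cons IHs pair_Mz.
Qed.

Lemma matched_expz N f f' (z : int) :
    tcoef f 0 = 1 -> tcoef f' 0 = 1 -> hom (f - 1) -> hom (f' - 1) ->
    (0 < N)%N -> matched N (f - 1) (f' - 1) ->
  matched N (f ^ z - 1) (f' ^ z - 1) /\
  matched N.+1 (f ^ z - 1 - (f - 1) *~ z) (f' ^ z - 1 - (f' - 1) *~ z).
Proof.
move=> f1 f1' hf hf' N0 mff.
have [] := filt_expz (filtered_matched C l0)
  (E := fun z => (f ^ z, f' ^ z) : tvring C * tvring C) (n := N) _ _ _ N0 _ z.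
- by [].
- by move=> y; congr pair; rewrite exprzDr // tvunit.
- move=> y; split; [exact: hom_expz|exact: hom_expz|exact: red0_expz|].
  exact: red0_expz.
- exact: mff.
move=> mz mz'; split; first exact: mz.
have {}mz' : matched_pair l N.+1 ((f ^ z - 1, f' ^ z - 1) - (f - 1, f' - 1) *~ z).
  exact: mz'.
by rewrite pair_Mz in mz'.
Qed.

Lemma hom_actsB v f (phi : tvaut C) u : acts v f phi -> hom (f - 1) ->
  hom u -> hom (phi u - u).
Proof.
move=> aphi hf hu n m w _; rewrite (tcf_actsB _ _ _ aphi).
apply: hom_twist hu _ => w'; apply: hom_expz => //.
by case: aphi.
Qed.

Lemma hom_acts v f (phi : tvaut C) u : acts v f phi -> hom (f - 1) ->
  hom (u - 1) -> hom (phi u - 1).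
Proof.
move=> aphi hf hu n; have -> : phi u - 1 = (phi u - u) + (u - 1) by ring.
apply: (filtD (filtered_cone C l)); last exact: hu.
by rewrite (rmorph_sub1 phi); apply: hom_actsB aphi hf hu n.
Qed.

(** As the involution changes the sign of the form, it exchanges theta_(v, f)
    with the inverse of the automorphism of the reflected ray. *)
Lemma matched_acts N v f f' (phi psi : tvaut C) u u' :
    acts v f phi -> acts (refl v) f'^-1 psi ->
    tcoef f' 0 = 1 -> hom (f - 1) -> hom (f' - 1) ->
    (0 < N)%N -> matched N (f - 1) (f' - 1) ->
    hom (u - 1) -> hom (u' - 1) -> red0 (u - 1) -> red0 (u' - 1) ->
    matched N (u - 1) (u' - 1) ->
  matched N.+1 (phi u - u) (psi u' - u').
Proof.
move=> aphi apsi f1' hf hf' N0 mff hu hu' u0 u0' muu z zC zN.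
have f1 : tcoef f 0 = 1 by case: aphi.
rewrite (rmorph_sub1 phi) (rmorph_sub1 psi) /hc.
rewrite (tcf_actsB _ _ _ aphi) (tcf_actsB _ _ _ apsi).
have -> : (fun w => f'^-1 ^ det (refl v) w - 1) =
    (fun w => (fun y => f' ^ det v y - 1) (refl w)).
  apply/funext => w; rewrite exprz_inv -{1}(reflK l w) det_refl opprK.
  by [].
refine (@twist_matched _ _ l0 N _ _ (fun y => f ^ det v y - 1)
  (fun y => f' ^ det v y - 1) z hu hu' u0 u0' muu _ zC zN); move=> w; split.
- exact: hom_expz.
- exact: hom_expz.
- exact: red0_expz.
- exact: red0_expz.
by have [] := matched_expz (det v w) f1 f1' hf hf' N0 mff.
Qed.

Lemma hom_wallS : hom (wallS C l - 1).
Proof. by move=> n; apply: cone_wallS. Qed.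

(** The involution exchanges the monomials of exponents (i, 1) and (l - i, 1),
    which have the same coefficient in the l-th power of 1 + t x. *)
Lemma matched_wallS N : matched N (wallS C l - 1) (wallS C l - 1).
Proof.
move=> v vC _.
have aux w : in_cone l w -> hc w (wallS C l - 1) != 0 ->
    exists2 i, (i <= l)%N & w = (i%:Z, 1).
  move=> wC; rewrite /hc tcf_wallS.
  case: andP => [[w0 /eqP wE]|]; last by rewrite eqxx.
  move=> _; exists (tdeg w).-1 => //; move: wC; rewrite in_coneE //.
  by rewrite (congr1 fst wE) (congr1 snd wE) /= mulr1 lez_nat.
have eqC i : (i <= l)%N -> hc (i%:Z, 1) (wallS C l - 1) = 'C(l, i)%:R.
  move=> il; rewrite /hc tcf_wallS.
  have -> : tdeg (i%:Z, 1) = i.+1 by rewrite /tdeg /=; lia.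
  by rewrite eqxx.
have reflE i : (i <= l)%N -> refl (i%:Z, 1) = ((l - i)%N%:Z, 1).
  by move=> il; rewrite /refl /= mulr1 subzn.
have both i : (i <= l)%N ->
    hc (i%:Z, 1) (wallS C l - 1) = hc (refl (i%:Z, 1)) (wallS C l - 1).
  by move=> il; rewrite reflE // !eqC ?leq_subr // bin_sub.
have [v0|/(aux v vC)[i il ->]] := eqVneq (hc v (wallS C l - 1)) 0.
  have [rv0|] := eqVneq (hc (refl v) (wallS C l - 1)) 0; first by rewrite v0 rv0.
  have rvC : in_cone l (refl v) by rewrite in_cone_refl.
  move=> /(aux _ rvC)[i il rvE]; have vE : v = refl (i%:Z, 1) by rewrite -rvE reflK.
  by rewrite vE reflK -both.
exact: both.
Qed.

End MatchedPairs.

(** * Reflection of the rays *)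

Section Symmetry.
Variable C : numDomainType.
Variables (l1 l2 : nat) (F : int * int -> tvring C) (th : int * int -> tvaut C).
Variables (U U' : tvring C -> tvring C).
Hypothesis rp : ray_product l1 l2 F th U U'.
Hypothesis l1_gt0 : (0 < l1)%N.
Implicit Types (u f g : tvring C) (v w : int * int).

Notation hom := (hom (C := C) l1).
Notation in_cone := (in_cone l1).
Notation refl := (refl l1).
Notation matched := (matched (C := C) l1).

Lemma ray_coef0 v : ray v -> tcoef (F v) 0 = 1.
Proof. by case/(rp_acts rp). Qed.

Lemma hom_ray v : ray v -> hom (F v - 1).
Proof. by move=> rv n m w _; apply: (cone_ray rp rv). Qed.

Lemma in_cone_multiple v k : in_cone (v *+ k.+1) = in_cone v.
Proof.
rewrite !in_coneE // !raddfMn /= mulrnAr pmulrn_lge0 //.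
by rewrite ler_pMn2r.
Qed.

(** Multiples of a ray outside of the cone are outside of the cone. *)
Lemma ray_out v : ray v -> ~~ in_cone v -> F v = 1.
Proof.
move=> rv vC; apply/eqP; rewrite -subr_eq0; apply/eqP/tvringP => n z.
rewrite raddf0; apply: contraNeq vC => vz; have [k zE] := ray_supp rp rv vz.
rewrite -(in_cone_multiple v k) -zE /in_cone.
by have zC := cone_ray rp rv vz; rewrite -(cone_tdeg zC).
Qed.

Lemma ray_refl v : ray v -> in_cone v -> ray (refl v).
Proof.
case: v => a b /and3P[/= a0 b0 ab]; rewrite in_coneE // => /andP[/= _ ab'].
rewrite /ray /= b0 subr_ge0 ab' /= /coprimez.
by rewrite gcdzC gcdzMDl gcdzN gcdzC.
Qed.

Lemma recip_refl v : 0 < v.2 -> recip (refl v) = l1%:R - recip v.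
Proof.
move=> v0; have vQ : v.2%:~R != 0 :> rat by rewrite intr_eq0 lt0r_neq0.
by rewrite /recip /= rmorphB rmorphM mulrBl mulfK.
Qed.

(** The involution reverses the order of the slopes. *)
Lemma rev_refl s : all ray s -> sorted ray_lt s ->
  map refl s =i s -> rev (map refl s) = s.
Proof.
move=> rs ss sE; apply: (irr_sorted_eq ray_lt_trans ray_lt_irr) => //.
  rewrite rev_sorted sorted_map; apply: (sub_in_sorted _ rs ss).
  move=> v w /and3P[_ v0 _] /and3P[_ w0 _].
  by rewrite /ray_lt /relpre /= !recip_refl // ltrD2l ltrN2.
by move=> v; rewrite mem_rev sE.
Qed.

(** The composite of the inverses along the reflected rays. *)
Definition tvcompose_refl s : tvring C -> tvring C :=
  foldr (fun v phi => tvinverse (th (refl v)) \o phi) id s.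

Lemma tvcompose_reflK s :
  cancel (tvcompose th (rev (map refl s))) (tvcompose_refl s).
Proof.
elim: s => //= v s IHs u; rewrite rev_cons tvcompose_rcons.
exact: etrans (congr1 (tvinverse (th (refl v))) (IHs _)) (tvaut_funK _ _).
Qed.

Lemma tvcompose_refl_eqt k s u g : all ray (map refl s) ->
  eqt k u g -> eqt k (tvcompose_refl s u) (tvcompose_refl s g).
Proof.
elim: s => //= v s IHs /andP[rv rs] ug.
have av := acts_inverse (rp_ray rp rv) (rp_acts rp rv).
exact: acts_eqt av (IHs rs ug).
Qed.

Lemma tvcompose_refl_x s : all ray (map refl s) ->
  tvcompose_refl s (tvx C) *
    foldr (fun v u => F (refl v) ^ (- v.2) * tvinverse (th (refl v)) u) 1 s
  = tvx C.
Proof.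
elim: s => [|v s IHs] /=; first by rewrite mulr1.
move=> /andP[rv rs]; have [f1 ix _] := acts_inverse (rp_ray rp rv) (rp_acts rp rv).
set K := foldr _ _ _ in IHs *; set i := tvinverse _ in ix *.
have aux (R : comUnitRingType) (x f : R) (b : int) : f \is a GRing.unit ->
    f ^ b * (x * f^-1 ^ b) = x.
  by move=> fU; rewrite exprz_inv mulrCA -exprzDr // subrr expr0z mulr1.
transitivity (F (refl v) ^ (- v.2) * i (tvcompose_refl s (tvx C) * K)).
  by rewrite rmorphM; apply: mulrCA.
rewrite (IHs rs) ix; apply: aux; apply: tvunit; exact: ray_coef0.
Qed.

Lemma reflMn v k : refl (v *+ k) = refl v *+ k.
Proof.
elim: k => [|k IHk]; first by rewrite !mulr0n -{1}(subrr v) -reflB subrr.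
rewrite !mulrS -IHk; apply/eqP; rewrite [eqbRHS]addrC -subr_eq reflB.
by rewrite addrC addrK.
Qed.

Lemma ray_refl_supp n z v : ray (refl v) ->
  tcf n (refl z) (F (refl v) - 1) != 0 -> exists k, z = v *+ k.+1.
Proof.
move=> rv /(ray_supp rp rv)[k zE]; exists k.
by rewrite -(reflK l1 z) zE reflMn reflK.
Qed.

(** On a list stable under the involution, the composite of the inverses along
    the reflected rays is the inverse of the product, so it maps x to x * W^l2
    modulo t^k. *)
Lemma foldr_refl k s : all ray s -> sorted ray_lt s ->
    map refl s =i s -> eq_mod_t k U (tvcompose th s) ->
  eqt k (foldr (fun v u => F (refl v) ^ (- v.2) * tvinverse (th (refl v)) u) 1 s)
        (wallS C l1 ^ (- (l2 : int))).
Proof.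
move=> rs ss sE Us.
have rs' : all ray (map refl s) by apply/allP => v; rewrite sE => /(allP rs).
have := tvcompose_refl_x rs'; set K := foldr _ _ _ => xK.
have Ux : eqt k (tvcompose_refl s (tvx C)) (U' (tvx C)).
  have e := Us (U' (tvx C)); rewrite (rp_K rp) in e.
  have := tvcompose_refl_eqt rs' e.
  have -> : tvcompose th s = tvcompose th (rev (map refl s)) by rewrite rev_refl.
  by rewrite tvcompose_reflK.
have WU : wallS C l1 \is a GRing.unit by apply: tvunit; apply: tcoef0_wallS.
have aux (R : comUnitRingType) (x W : R) : W \is a GRing.unit ->
    x * W ^ (l2 : int) * W ^ (- (l2 : int)) = x.
  by move=> WU'; rewrite -mulrA -exprzDr // subrr expr0z mulr1.
have e1 : eqt k (U' (tvx C) * K) (U' (tvx C) * wallS C l1 ^ (- (l2 : int))).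
  apply: (@eqt_trans _ _ _ (tvcompose_refl s (tvx C) * K)).
    by apply: eqtM => //; apply: eqt_sym.
  by rewrite xK (rp_x' rp) aux.
apply: eqt_mulKl e1; rewrite (rp_x' rp).
by rewrite unitrM unitrXz // andbT; apply: tvmon_unit.
Qed.

Lemma hc_eqt k v u f : eqt k u f -> (tdeg v < k)%N -> hc v u = hc v f.
Proof. by move=> uf vk; rewrite /hc /tcf uf. Qed.

Lemma tdeg_bound N v : in_cone v -> v.2 < N.+1%:Z -> (tdeg v < (l1.+1 * N).+1)%N.
Proof.
rewrite in_coneE // /tdeg => /andP[v1 v12] vN.
have v2 : 0 <= v.2 by rewrite -(@pmulr_rge0 _ l1%:Z) //; apply: le_trans v12.
rewrite ltnS -lez_nat gez0_abs ?addr_ge0 // PoszM intS mulrDl mul1r addrC.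
have v2N : v.2 <= N by move: vN; lia.
by apply: lerD => //; apply: le_trans v12 _; rewrite ler_wpM2l.
Qed.

(** One step of the induction on the degree in y, by [filt_foldr] in the ring of
    pairs: the image of x under the product and under its mirror image, divided
    by x, are both W^-l2 modulo t^k, and this series is its own mirror image. *)
Lemma matched_step N : (0 < N)%N ->
    (forall v, ray v -> in_cone v -> matched N (F v - 1) (F (refl v) - 1)) ->
  forall v, ray v -> in_cone v -> matched N.+1 (F v - 1) (F (refl v) - 1).
Proof.
(* In the cone, degree at most N in y means degree at most (l1 + 1) * N in t. *)
move=> N0 IH v rv vC; pose k := (l1.+1 * N).+1.
have [s0 rs0 Us0] := ray_product_list k rp.
pose t := v :: filter in_cone s0; pose s := sort_rays (t ++ map refl t).
have tP w : w \in t -> ray w && in_cone w.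
  rewrite inE => /predU1P[->|]; first by rewrite rv.
  by rewrite mem_filter => /andP[-> /(allP rs0) ->].
have sP w : w \in s -> ray w && in_cone w.
  rewrite mem_sort_rays mem_cat => /orP[/tP //|/mapP[y /tP/andP[ry yC] ->]].
  by rewrite ray_refl // in_cone_refl.
have rs : all ray s by apply/allP => w /sP/andP[].
have Cs : all in_cone s by apply/allP => w /sP/andP[].
have ss : sorted ray_lt s.
  by apply: sorted_sort_rays; apply/allP => w; rewrite -mem_sort_rays => /(allP rs).
have us : uniq s by rewrite sort_uniq undup_uniq.
have sE : map refl s =i s.
  have imp w : w \in s -> refl w \in s.
    rewrite !mem_sort_rays !mem_cat => /orP[wt|/mapP[y yt ->]].
      by rewrite map_f ?orbT.
    by rewrite reflK yt.
  move=> w; apply/mapP/idP => [[y ys ->]|ws]; first exact: imp.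
  by exists (refl w); rewrite ?reflK //; apply: imp.
have vs : v \in s by rewrite mem_sort_rays mem_cat mem_head.
have Us : eq_mod_t k U (tvcompose th s).
  apply: Us0 => // w ws0 ws; apply: (ray_out (allP rs0 w ws0)).
  apply: contra ws => wC; rewrite mem_sort_rays mem_cat inE mem_filter wC ws0.
  by rewrite orbT.
have rr w : w \in s -> ray (refl w).
  by move=> /sP/andP[rw wC]; apply: ray_refl.
have [||_ _] := filt_foldr (filtered_matched C l1_gt0) (s := s) (n := N)
  (kappa := fun w => (F w ^ (- w.2), F (refl w) ^ (- w.2)) : tvring C * tvring C)
  (Theta := fun w p => (th w p.1, tvinverse (th (refl w)) p.2)) N0.
- move=> w ws; have /andP[rw wC] := sP w ws; have rw' := rr w ws.
  split.
    by split; [apply: hom_expz|apply: hom_expz|apply: red0_expz|apply: red0_expz];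
      (apply: ray_coef0 || apply: hom_ray).
  by have [] := matched_expz l1_gt0 (- w.2) (ray_coef0 rw) (ray_coef0 rw')
    (hom_ray rw) (hom_ray rw') N0 (IH w rw wC).
- move=> w ws [u u'] [/= hu hu' u0 u0'] Vu.
  have /andP[rw wC] := sP w ws; have rw' := rr w ws.
  have aw := rp_acts rp rw.
  have aw' := acts_inverse (rp_ray rp rw') (rp_acts rp rw').
  have hV : hom ((F (refl w))^-1 - 1).
    by rewrite -exprN1; apply: hom_expz (ray_coef0 rw') (hom_ray rw').
  split.
    split.
    - exact: hom_acts aw (hom_ray rw) hu.
    - exact: hom_acts aw' hV hu'.
    - exact: red0_acts aw u0.
    - exact: red0_acts aw' u0'.
  exact: (matched_acts l1_gt0 aw aw' (ray_coef0 rw') (hom_ray rw) (hom_ray rw') N0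
    (IH w rw wC) hu hu' u0 u0' Vu).
set KK := foldr _ _ _ => VKS.
pose K := foldr (fun w u => F w ^ (- w.2) * th w u) 1 s.
pose K' := foldr (fun w u => F (refl w) ^ (- w.2) * tvinverse (th (refl w)) u) 1 s.
have KE : KK = (K, K') by exact: foldr_pair.
have KD : eqt k K (wallS C l1 ^ (- (l2 : int))).
  exact: (foldr_wallS rp rs (Us _)).
have KD' : eqt k K' (wallS C l1 ^ (- (l2 : int))) by apply: foldr_refl.
have VK : matched_pair l1 N.+1 (KK - 1).
  rewrite KE => z zC zN; have zk := tdeg_bound zC zN.
  have zk' : (tdeg (refl z) < k)%N by apply: tdeg_bound; rewrite ?in_cone_refl.
  rewrite /= !hcB (hc_eqt KD zk) (hc_eqt KD' zk') -!hcB.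
  have w1 := tcoef0_wallS C l1; have hw := @hom_wallS C l1.
  have [+ _] := matched_expz l1_gt0 (- (l2 : int)) w1 w1 hw hw (ltn0Sn N)
    (@matched_wallS C l1 l1_gt0 N.+1).
  exact.
have {VKS} : matched_pair l1 N.+1
    (\sum_(w <- s) (F w - 1, F (refl w) - 1) *~ (- w.2)).
  apply: (filt_sum (filtered_matched C l1_gt0) VK VKS) => w ws.
  have /andP[rw wC] := sP w ws; have rw' := rr w ws.
  have [_] := matched_expz l1_gt0 (- w.2) (ray_coef0 rw) (ray_coef0 rw')
    (hom_ray rw) (hom_ray rw') N0 (IH w rw wC).
  by rewrite pair_Mz.
rewrite pair_sumMz => VS z zC zN; have := VS z zC zN; rewrite /hc /=.
have v0 : - v.2 != 0 by rewrite oppr_eq0; case/and3P: rv => _ /lt0r_neq0.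
have [[k' zE]|nz] := pselect (exists k', z = v *+ k'.+1).
  rewrite (tcf_sum_ray _ rs us vs zE); last first.
    by move=> w /(allP rs) rw; apply: (ray_supp rp rw).
  rewrite (tcf_sum_ray _ rs us vs zE); last first.
    by move=> w ws; apply: (ray_refl_supp (rr w ws)).
  by move=> /eqP; rewrite -subr_eq0 -mulrzBl mulrz_eq0 (negPf v0) subr_eq0 => /eqP.
move=> _; have [->|/(ray_supp rp rv)//] := eqVneq (tcf (tdeg z) z (F v - 1)) 0.
apply/esym/eqP; apply: contra_notT nz; apply: ray_refl_supp; exact: rr.
Qed.

Lemma matched_ray N v : ray v -> in_cone v ->
  matched N.+1 (F v - 1) (F (refl v) - 1).
Proof.
elim: N v => [|N IHN] v rv vC; last exact: matched_step.
have rv' := ray_refl rv vC.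
apply: (filt1 (filtered_matched C l1_gt0) (p := (F v - 1, F (refl v) - 1))).
split; [exact: hom_ray|exact: hom_ray| |].
  exact: (red0_expz 1 (ray_coef0 rv)).
exact: (red0_expz 1 (ray_coef0 rv')).
Qed.

(** Nontrivial rays lie in the cone 0 <= a <= l1 * b, and the involution
    exchanging (a, b) and (l1 * b - a, b) permutes them. *)
Theorem ray_reflection v : ray v -> F v <> 1 ->
  v.1 <= l1%:Z * v.2 /\ F (refl v) <> 1.
Proof.
move=> rv Fv; have [vC|/(ray_out rv)//] := boolP (in_cone v).
split=> [|Fv']; first by move: vC; rewrite in_coneE // => /andP[].
apply: Fv; apply/eqP; rewrite -subr_eq0; apply/eqP/tvringP => n z.
rewrite raddf0; apply/eqP/negP => /negP vz; have zC := cone_ray rp rv vz.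
have nE := cone_tdeg zC; rewrite nE in zC vz.
have zN : z.2 < (absz z.2).+1%:Z by lia.
have := matched_ray rv vC zC zN; rewrite Fv' subrr /hc raddf0 => z0.
by rewrite z0 eqxx in vz.
Qed.

End Symmetry.

(** * From the commutator to an ordered product over rays *)

Section WallFunctions.
Variable C : comNzRingType.
Implicit Types (u f g : tvring C) (v w : int * int).

Lemma lmonX v i : lmon C v ^+ i = lmonom (v *+ i) 1.
Proof.
elim: i => [|i IHi]; first by rewrite expr0.
by rewrite exprS IHi mulrS /lmon lmonomM mulr1.
Qed.

Lemma tvsubst_supp v (g : tseries {poly C}) n w :
  tcf n w (tvsubst v g) != 0 -> exists i : nat, w = v *+ i.
Proof.
rewrite /tcf /= horner_coef raddf_sum => sum0.
apply: contrapT => no; case/eqP: sum0; rewrite big1 // => i _.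
rewrite lmonX /= coef_map_id0; last exact: lmonom0.
rewrite /laurentC lmonomM add0r lcoefU; case: eqP => // wE.
by case: no; exists i.
Qed.

Lemma wall_function_supp v f : is_wall_function v f ->
  tcoef f 0 = 1 /\ on_ray v f.
Proof.
case=> g fE; have {}fE : f = 1 + tvt C * (tvmon C v * tvsubst v g).
  have aux (R : comNzRingType) (a b c : R) : 1 + a * b * c = 1 + a * (b * c).
    by rewrite mulrA.
  by rewrite fE; apply: aux.
split; first by rewrite fE tcoefD tcoef_tM0 addr0.
move=> n w; rewrite fE raddfD /= tcf1; case: n => [|n].
  rewrite tcf_tM0 addr0 /= => w0; left; split=> //.
  by apply/eqP; move: w0; case: (w == 0); rewrite ?eqxx.
rewrite add0r tcf_tMS tcf_monM => /tvsubst_supp[i /eqP].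
rewrite subr_eq addrC -mulrS => /eqP wE; right; split=> //.
by exists i.
Qed.

Lemma theta_acts v f (phi : tvaut C) : is_theta v f phi ->
  on_ray v f /\ acts v f phi.
Proof. by case=> _ /wall_function_supp[f1 rf] phix phiy. Qed.

End WallFunctions.

(** The data of a factorization of T^-1 S T S^-1, keeping of the wall functions
    only their supports. *)
Section Factorizations.
Variable C : comNzRingType.

(** The wall functions of S and T. *)
Definition wallx (l : nat) : tvring C := (1 + tvt C * tvx C) ^+ l.
Definition wally (l : nat) : tvring C := (1 + tvt C * tvy C) ^+ l.

Record factorization (l1 l2 : nat) (S T : tvaut C) (th : int * int -> tvaut C)
    (f : int * int -> tvring C) : Prop := FactorizationOf {
  fact_rayS : on_ray (1, 0) (wallx l1);
  fact_actsS : acts (1, 0) (wallx l1) S;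
  fact_rayT : on_ray (0, 1) (wally l2);
  fact_actsT : acts (0, 1) (wally l2) T;
  fact_ray : forall v, first_quadrant_primitive v -> on_ray v (f v);
  fact_acts : forall v, first_quadrant_primitive v -> acts v (f v) (th v);
  fact_prod :
    is_ordered_product th (tvaut_inv T \o S \o T \o tvaut_inv S)
}.

Lemma commutator_factorizationP l1 l2 f :
  is_commutator_factorization l1 l2 f ->
  exists S T th, @factorization l1 l2 S T th f.
Proof.
case=> S [T [th [thS thT thf prod]]]; exists S, T, th.
have [rS aS] := theta_acts thS; have [rT aT] := theta_acts thT.
split; [exact: rS|exact: aS|exact: rT|exact: aT| | |exact: prod].
  by move=> v /thf/theta_acts[].
by move=> v /thf/theta_acts[].
Qed.

Section RayProduct.
Variables (l1 l2 : nat) (S T : tvaut C) (th : int * int -> tvaut C).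
Variable (f : int * int -> tvring C).
Hypothesis fact : factorization l1 l2 S T th f.

(** The family f extended by T along the ray (0, 1). *)
Definition ray_wall v := if v == (0, 1) then wally l2 else f v.
Definition ray_aut v := if v == (0, 1) then T else th v.

Lemma rmorph_wall (R : comUnitRingType) (phi : {rmorphism R -> R})
    (t y h : R) (n : nat) :
    phi t = t -> phi y = y * h ^ (1 : int) ->
  phi ((1 + t * y) ^+ n) = (1 + t * y * h) ^+ n.
Proof.
move=> phit phiy; rewrite rmorphXn rmorphD rmorph1 rmorphM phit phiy.
by rewrite expr1z mulrA.
Qed.

(** The conjugate of psi by phi, where phi fixes x. *)
Lemma commutator_x (R : comUnitRingType) (phi psi : {rmorphism R -> R})
    (phi' : R -> R) (x g h : R) (z : int) (n : nat) :
    cancel phi phi' -> phi x = x -> g \is a GRing.unit ->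
    psi x = x * g ^ z -> phi g = h ^+ n ->
  phi (psi (phi' x)) = x * h ^ (n%:Z * z).
Proof.
move=> phiK phix gU psix phig; have -> : phi' x = x by rewrite -{1}phix phiK.
by rewrite psix rmorphM phix rmorphXz // phig -exprz_exp.
Qed.

Lemma factorization_ray_product :
  ray_product l1 l2 ray_wall ray_aut
    (S \o T \o tvaut_inv S) (S \o tvinverse T \o tvaut_inv S).
Proof.
have [f1S Sx Sy] := fact_actsS fact.
have aT := fact_actsT fact; have [f1T Tx Ty] := aT.
have [f1T' Tx' Ty'] := acts_inverse (fact_rayT fact) aT.
have gU := tvunit f1T.
have {}Sx : S (tvx C) = tvx C by rewrite Sx /= oppr0 expr0z mulr1.
have Sg : S (wally l2) = wallS C l1 ^+ l2.
  exact: (@rmorph_wall (tvring C) S _ _ _ l2 (tvaut_t S) Sy).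
split.
- move=> v rv; rewrite /ray_wall; case: eqP => [->|/eqP v01].
    exact: fact_rayT fact.
  by apply: (fact_ray fact); rewrite ray_first_quadrant rv.
- move=> v rv; rewrite /ray_wall /ray_aut; case: eqP => [->|/eqP v01].
    exact: aT.
  by apply: (fact_acts fact); rewrite ray_first_quadrant rv.
- move=> u; apply: etrans (congr1 (fun z => S (T z)) (tvaut_funK S _)) _.
  exact: etrans (congr1 S (tvaut_invK T _)) (tvaut_invK S u).
- have := @commutator_x (tvring C) S T _ _ _ _ _ l2 (tvaut_funK S) Sx gU Tx Sg.
  by rewrite mulrN1.
- have Tx2 : tvinverse T (tvx C) = tvx C * wally l2 ^ (1 : int).
    apply: etrans Tx' _; congr (_ * _); exact: exprz_inv.
  have := @commutator_x (tvring C) S (tvinverse T) _ _ _ _ _ l2 (tvaut_funK S) Sx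
    gU Tx2 Sg.
  by rewrite mulr1.
move=> k; have [s [rs ss triv prod]] := fact_prod fact k.
have ths w : w \in s -> ray_aut w = th w /\ ray w.
  move=> /(allP rs); rewrite ray_first_quadrant => /andP[rw w01].
  by rewrite /ray_aut (negPf w01).
(* T, of infinite slope, stands first in the product. *)
exists ((0, 1) :: s); split.
- by apply/andP; split=> //; apply/allP => w /ths[].
- rewrite /= path_min_sorted.
    apply: (sub_in_sorted _ rs ss) => v w.
    by move=> /and3P[v1 v2 _] /and3P[w1 w2 _]; rewrite slope_ray.
  apply/allP => w /(allP rs)/and3P[w1 w2 _]; rewrite /ray_lt /recip /= mul0r.
  by rewrite divr_gt0 ?ltr0z.
- move=> v rv; rewrite inE negb_or => /andP[v01 vs].
  by rewrite /ray_aut (negPf v01); apply: triv => //; rewrite ray_first_quadrant rv.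
move=> u /=; have -> : ray_aut (0, 1) = T by [].
have -> : S (T (tvaut_inv S u)) = T (tvaut_inv T (S (T (tvaut_inv S u)))).
  by rewrite (tvaut_invK T).
apply: (acts_eqt aT); have -> : tvcompose ray_aut s u = tvcompose th s u.
  elim: (s) ths => //= w s' IHs ths; have [-> _] := ths w (mem_head _ _).
  by rewrite IHs // => w' w's; apply: ths; rewrite inE w's orbT.
exact: prod.
Qed.

End RayProduct.
End Factorizations.

(** * Exchanging x and y *)

Section Swap.
Variable C : comNzRingType.
Implicit Types (p q : laurent C) (u f g : tvring C) (v w : int * int).

Definition swap v : int * int := (v.2, v.1).

Lemma swapK : involutive swap. Proof. by case. Qed.

Lemma swapMn v k : swap (v *+ k) = swap v *+ k.
Proof. by elim: k => // k IHk; rewrite !mulrS -IHk. Qed.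

(** The exchange of x and y on Laurent polynomials. *)
Definition lswap p : laurent C := \sum_(v <- msupp p) lmonom (swap v) (lcoef v p).

Lemma lcoef_swap v p : lcoef v (lswap p) = lcoef (swap v) p.
Proof.
rewrite raddf_sum /=; under eq_bigr => w _ do rewrite lcoefU.
have [vp|vp] := boolP (swap v \in msupp p).
  rewrite (bigD1_seq (swap v)) ?fset_uniq //= swapK eqxx mulr1n.
  rewrite big1 ?addr0 // => w /negPf wv.
  by rewrite -(inj_eq (can_inj swapK)) swapK wv.
rewrite (lcoef_supp vp) big_seq big1 // => w wp.
by case: eqP => // wv; rewrite -wv swapK wp in vp.
Qed.

Lemma lswapK : involutive lswap.
Proof. by move=> p; apply: lcoefP => v; rewrite !lcoef_swap swapK. Qed.

Fact lswap_is_zmod_morphism : zmod_morphism lswap.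
Proof.
move=> p q; apply: lcoefP => v.
have lB w p' q' : lcoef w (p' - q') = lcoef w p' - lcoef w q' by exact: raddfB.
apply: etrans (lcoef_swap _ _) (etrans (lB _ _ _) _).
apply: etrans (esym (lB _ _ _)); congr (_ - _); exact/esym/lcoef_swap.
Qed.

HB.instance Definition _ :=
  GRing.isZmodMorphism.Build (laurent C) (laurent C) lswap lswap_is_zmod_morphism.

Lemma lswapU v (c : C) : lswap (lmonom v c) = lmonom (swap v) c.
Proof.
apply: lcoefP => w; rewrite lcoef_swap !lcoefU.
by rewrite -(inj_eq (can_inj swapK)) swapK.
Qed.

Lemma lswapM p q : lswap (p * q) = lswap p * lswap q.
Proof.
have lD p' q' : lswap (p' + q') = lswap p' + lswap q' by exact: raddfD.
elim/laurent_ind: p => [|p p' IHp IHp'|c v].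
- by rewrite mul0r raddf0 mul0r.
- apply: etrans (congr1 lswap (mulrDl p p' q)) _.
  apply: etrans (etrans (lD _ _) (congr2 +%R IHp IHp')) _.
  exact: esym (etrans (congr1 (fun z => z * lswap q) (lD p p')) (mulrDl _ _ _)).
elim/laurent_ind: q => [|q q' IHq IHq'|d w].
- by rewrite mulr0 raddf0 mulr0.
- apply: etrans (congr1 lswap (mulrDr _ q q')) _.
  apply: etrans (etrans (lD _ _) (congr2 +%R IHq IHq')) _.
  exact: esym (etrans (congr1 ( *%R _) (lD q q')) (mulrDr _ _ _)).
apply: etrans (congr1 lswap (lmonomM v w c d)) _.
apply: etrans (lswapU _ _) _; apply: etrans (esym (lmonomM (swap v) (swap w) c d)) _.
exact: esym (congr2 *%R (lswapU v c) (lswapU w d)).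
Qed.

(** The automorphism exchanging x and y. *)
Definition tswap u : tvring C := tmap lswap u.

Fact tswap_is_zmod_morphism : zmod_morphism tswap.
Proof. by move=> u f; apply: tseriesP => n; rewrite /= raddfB. Qed.

Fact tswap_is_monoid_morphism : monoid_morphism tswap.
Proof.
split.
  apply: tseriesP => -[|n] /=; last exact: raddf0.
  exact: lswapU.
move=> u f; apply: tseriesP => n /=; rewrite raddf_sum; apply: eq_bigr => i _.
exact: lswapM.
Qed.

HB.instance Definition _ :=
  GRing.isZmodMorphism.Build (tvring C) (tvring C) tswap tswap_is_zmod_morphism.
HB.instance Definition _ :=
  GRing.isMonoidMorphism.Build (tvring C) (tvring C) tswap tswap_is_monoid_morphism.

Lemma tswapK : involutive tswap.
Proof. by move=> u; apply: tseriesP => n; apply: lswapK. Qed.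

Lemma tcf_swap n v u : tcf n v (tswap u) = tcf n (swap v) u.
Proof. exact: lcoef_swap. Qed.

Lemma tswap_mon v : tswap (tvmon C v) = tvmon C (swap v).
Proof. by apply: tseriesP => -[|n] /=; [apply: lswapU|apply: raddf0]. Qed.

Lemma tswap_t : tswap (tvt C) = tvt C.
Proof.
apply: tseriesP => -[|[|n]] /=; [exact: raddf0| |exact: raddf0].
exact: lswapU.
Qed.

Lemma tswap_scalar c : tswap (tvscalar c) = tvscalar c.
Proof. by apply: tseriesP => n; apply: lswapU. Qed.

Lemma tswap_eqt k u f : eqt k u f -> eqt k (tswap u) (tswap f).
Proof. by move=> uf n /uf /= ->. Qed.

Section Conjugate.
Variable phi : tvaut C.

Definition swap_fun u := tswap (phi (tswap u)).
Definition swap_inv u := tswap (tvaut_inv phi (tswap u)).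

Fact swap_fun_is_zmod_morphism : zmod_morphism swap_fun.
Proof. by move=> u f; rewrite /swap_fun !raddfB. Qed.

Fact swap_fun_is_monoid_morphism : monoid_morphism swap_fun.
Proof.
split; first by rewrite /swap_fun !rmorph1.
move=> u f; rewrite /swap_fun.
apply: etrans (rmorphM tswap _ _); apply: (congr1 tswap).
exact: etrans (congr1 phi (rmorphM tswap _ _)) (rmorphM phi _ _).
Qed.

HB.instance Definition _ :=
  GRing.isZmodMorphism.Build (tvring C) (tvring C) swap_fun swap_fun_is_zmod_morphism.
HB.instance Definition _ :=
  GRing.isMonoidMorphism.Build (tvring C) (tvring C) swap_fun swap_fun_is_monoid_morphism.

Fact swap_funK : cancel swap_fun swap_inv.
Proof. by move=> u; rewrite /swap_inv /swap_fun tswapK tvaut_funK tswapK. Qed.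

Fact swap_invK : cancel swap_inv swap_fun.
Proof. by move=> u; rewrite /swap_inv /swap_fun tswapK tvaut_invK tswapK. Qed.

Fact swap_scalar c : swap_fun (tvscalar c) = tvscalar c.
Proof. by rewrite /swap_fun tswap_scalar tvaut_scalar tswap_scalar. Qed.

(** The conjugate of phi by the exchange of x and y. *)
Definition swap_aut : tvaut C :=
  @TVAut C swap_fun swap_inv swap_funK swap_invK swap_scalar.

End Conjugate.

Lemma on_ray_swap v f : on_ray v f -> on_ray (swap v) (tswap f).
Proof.
move=> rf n w; rewrite tcf_swap => /rf[[-> w0]|[n0 [k wE]]].
  by left; split=> //; rewrite -(swapK w) w0.
by right; split=> //; exists k; rewrite -(swapK w) wE swapMn.
Qed.

Lemma acts_swap v f (phi : tvaut C) : on_ray v f -> acts v f phi ->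
  acts (swap v) (tswap f) (swap_aut (tvinverse phi)).
Proof.
move=> rf aphi; have [f1 _ _] := aphi; have fU := tvunit f1.
have [_ ix iy] := acts_inverse rf aphi.
have sx : tswap (tvx C) = tvy C by exact: tswap_mon.
have sy : tswap (tvy C) = tvx C by exact: tswap_mon.
have aux (R : comUnitRingType) (tau : {rmorphism R -> R}) (i : R -> R)
    (x y h : R) (z : int) : h \is a GRing.unit -> tau x = y -> tau y = x ->
    i y = y * h^-1 ^ z -> tau (i (tau x)) = x * tau h ^ (- z).
  move=> hU xy yx iy'; rewrite xy iy' rmorphM yx exprz_inv rmorphXz //.
split.
- by rewrite /tswap /= f1; apply: lswapU.
- exact: (aux (tvring C) tswap (tvinverse phi) _ _ _ _ fU sx sy iy).
have := aux (tvring C) tswap (tvinverse phi) _ _ _ _ fU sy sx ix.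
by rewrite opprK.
Qed.

Lemma tvinverse_eqt k (phi : tvaut C) :
  eq_mod_t k phi id -> eq_mod_t k (tvinverse phi) id.
Proof.
move=> phi1 u n nk; rewrite -[X in _ = tcoef X n](tvaut_invK phi u).
exact/esym/phi1.
Qed.

Lemma tvcompose_swapK (th : int * int -> tvaut C) s u :
  tvcompose (fun v => swap_aut (tvinverse (th (swap v)))) (rev (map swap s))
    (tswap (tvcompose th s u)) = tswap u.
Proof.
set th' := fun v => _; elim: s u => [|v s IHs] u; first by [].
have step y : th' (swap v) (tswap (th v y)) = tswap y.
  rewrite /th' swapK; apply: (congr1 tswap).
  exact: etrans (congr1 (tvaut_inv (th v)) (tswapK _)) (tvaut_funK (th v) y).
rewrite [map _ _]/= rev_cons tvcompose_rcons.
exact: etrans (congr1 (tvcompose _ _) (step _)) (IHs u).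
Qed.

(** The exchange of x and y changes the orientation, hence turns theta_(v, f)
    into the inverse of an automorphism along the swapped ray; inverting the whole
    factorization gives one where l1 and l2, and S and T, are exchanged. *)
Lemma factorization_swap l1 l2 S T th (f : int * int -> tvring C) :
  @factorization C l1 l2 S T th f ->
  @factorization C l2 l1 (swap_aut (tvinverse T)) (swap_aut (tvinverse S))
    (fun v => swap_aut (tvinverse (th (swap v)))) (fun v => tswap (f (swap v))).
Proof.
move=> fact.
have sx : tswap (tvx C) = tvy C by exact: tswap_mon.
have sy : tswap (tvy C) = tvx C by exact: tswap_mon.
have aux (R : nzRingType) (tau : {rmorphism R -> R}) (t x y : R) n :
    tau t = t -> tau x = y -> tau ((1 + t * x) ^+ n) = (1 + t * y) ^+ n.
  by move=> tt xy; rewrite rmorphXn rmorphD rmorph1 rmorphM tt xy.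
have wx : tswap (wally C l2) = wallx C l2 := aux _ tswap _ _ _ _ tswap_t sy.
have wy : tswap (wallx C l1) = wally C l1 := aux _ tswap _ _ _ _ tswap_t sx.
have qswap v : first_quadrant_primitive (swap v) = first_quadrant_primitive v.
  rewrite /first_quadrant_primitive /= andbCA; congr [&& _, _ & _].
  by rewrite coprimez_sym.
have rS := fact_rayS fact; have aS := fact_actsS fact.
have rT := fact_rayT fact; have aT := fact_actsT fact.
have rf v : first_quadrant_primitive v -> on_ray (swap v) (f (swap v)).
  by rewrite -qswap; apply: (fact_ray fact).
have af v : first_quadrant_primitive v -> acts (swap v) (f (swap v)) (th (swap v)).
  by rewrite -qswap; apply: (fact_acts fact).
set th' := fun v => swap_aut (tvinverse (th (swap v))).
have af' v : first_quadrant_primitive v -> acts v (tswap (f (swap v))) (th' v).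
  by move=> fv; rewrite -{1}(swapK v); apply: acts_swap (rf v fv) (af v fv).
split.
- by rewrite -wx; apply: on_ray_swap rT.
- by rewrite -wx; apply: acts_swap rT aT.
- by rewrite -wy; apply: on_ray_swap rS.
- by rewrite -wy; apply: acts_swap rS aS.
- by move=> v fv; rewrite -{1}(swapK v); apply: on_ray_swap (rf v fv).
- exact: af'.
move=> k; have [s [rs ss triv prod]] := fact_prod fact k.
exists (rev (map swap s)); split.
- by rewrite all_rev all_map; apply: sub_all rs => v; rewrite /= qswap.
- rewrite rev_sorted sorted_map; apply: (sub_in_sorted _ rs ss) => v w.
  move=> /and3P[v1 v2 _] /and3P[w1 w2 _]; rewrite slope_ray // /relpre /=.
- move=> v fv; rewrite mem_rev -{1}(swapK v) mem_map; last exact: can_inj swapK.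
  move=> vs; have th1 : eq_mod_t k (th (swap v)) id by apply: triv; rewrite ?qswap.
  move=> u; apply: eqt_trans (tswap_eqt (tvinverse_eqt th1 _)) _.
  by rewrite tswapK.
move=> u; set phi' := _ \o _.
pose g := tvaut_inv S (T (tswap u)).
have chain (A : Type) (t a b c d : A -> A) (x : A) : involutive t ->
    t (a (t (t (b (t (t (c (t (t (d (t x))))))))))) = t (a (b (c (d (t x))))).
  by move=> tK; rewrite !tK.
have phiE : phi' u = tswap (S (tvaut_inv T g)).
  exact: (@chain _ tswap S (tvaut_inv T) (tvaut_inv S) T u tswapK).
have gE : (tvaut_inv T \o S \o T \o tvaut_inv S) (S (tvaut_inv T g)) = tswap u.
  apply: etrans (congr1 (fun z => tvaut_inv T (S (T z))) (tvaut_funK S _)) _.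
  apply: etrans (congr1 (fun z => tvaut_inv T (S z)) (tvaut_invK T _)) _.
  exact: etrans (congr1 (tvaut_inv T) (tvaut_invK S _)) (tvaut_funK T _).
have := prod (S (tvaut_inv T g)); rewrite gE => {}prod.
have cont t x y : all first_quadrant_primitive t -> eqt k x y ->
    eqt k (tvcompose th' t x) (tvcompose th' t y).
  elim: t => [_|v t IHt /andP[fv ft]] xy; first exact: xy.
  exact: acts_eqt (af' v fv) (IHt ft xy).
apply: (@eqt_trans _ _ _ (tvcompose th' (rev (map swap s))
    (tswap (tvcompose th s (S (tvaut_inv T g)))))).
  by rewrite phiE /th' (tvcompose_swapK th s).
apply: (@eqt_trans _ _ _ (tvcompose th' (rev (map swap s)) (tswap (tswap u)))).
  apply: cont; last by apply: tswap_eqt; apply: eqt_sym.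
  by rewrite all_rev all_map; apply: sub_all rs => v; rewrite /= qswap.
by rewrite tswapK.
Qed.

End Swap.

(** * Partitions and reflections *)

Section Permissibility.
Implicit Types (l a b k : nat).
Local Open Scope nat_scope.

(** Permissibility witnessed by parts p_i <= b * k and q_j <= a * k, so that
    b * k - p_i and a * k - q_j are again parts. *)
Definition box_permissible l1 l2 a b :=
  exists k (p : l1.-tuple nat) (q : l2.-tuple nat),
    [/\ 0 < k, \sum_(i < l1) tnth p i = a * k, \sum_(j < l2) tnth q j = b * k,
        \sum_(i < l1) tnth p i ^ 2 + \sum_(j < l2) tnth q j ^ 2 + k
          <= a * b * k ^ 2 + 2
      & (forall i, tnth p i <= b * k) /\ (forall j, tnth q j <= a * k)].

Lemma box_permissibleC l1 l2 a b :
  box_permissible l1 l2 a b -> box_permissible l2 l1 b a.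
Proof.
case=> k [p [q [k0 sp sq le_pq [pb qa]]]]; exists k, q, p; split=> //.
by rewrite [\sum_(i < l2) _ + _]addnC (mulnC b).
Qed.

(** Replacing each p_i by b * k - p_i does not change the defining expression,
    a * b * k^2 - k - sum p_i^2 - sum q_j^2 + 2. *)
Lemma box_permissible_refl l1 l2 a a' b : a <= a' -> a + a' = l1 * b ->
  box_permissible l1 l2 a b -> box_permissible l1 l2 a' b.
Proof.
move=> aa' aE [k [p [q [k0 sp sq le_pq [pb qa]]]]].
exists k, [tuple b * k - tnth p i | i < l1], q.
have cst c : \sum_(i < l1) c = l1 * c by rewrite sum_nat_const card_ord.
have s1 : \sum_(i < l1) (b * k - tnth p i) + a * k = l1 * (b * k).
  rewrite -sp -big_split -cst.
  by apply: eq_bigr => i _ /=; rewrite subnK.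
have s2 : \sum_(i < l1) (b * k - tnth p i) ^ 2 + 2 * (b * k) * (a * k) =
    \sum_(i < l1) tnth p i ^ 2 + l1 * (b * k) ^ 2.
  rewrite -sp big_distrr -big_split -cst -big_split; apply: eq_bigr => i _ /=.
  move: (pb i) => pbi.
  by rewrite -{2 3}(subnK pbi); nia.
under eq_bigr => i _ do rewrite tnth_mktuple.
split=> //.
- by apply: (@addIn (a * k)); rewrite s1 -mulnDl [a' + a]addnC aE mulnA.
- under eq_bigr => i _ do rewrite tnth_mktuple.
  move: s2 le_pq; set A := \sum_(i < l1) _; set B := \sum_(i < l1) _.
  set D := \sum_(j < l2) _ => s2 le_pq.
  have aE2 : a * (b * k ^ 2) + a' * (b * k ^ 2) = l1 * (b * k) ^ 2.
    by rewrite -mulnDl aE expnMn; ring.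
  nia.
split=> [i|j]; rewrite ?tnth_mktuple ?leq_subr //.
by rewrite (leq_trans (qa j)) // leq_mul2r aa' orbT.
Qed.

Lemma sum_ltn_ord l a : a <= l -> \sum_(i < l) (i < a : nat) = a.
Proof.
move=> al; rewrite -big_mkcond /= -(big_ord_widen l (fun=> 1) al).
by rewrite sum1_card card_ord.
Qed.

(** For k = 1 and parts equal to 0 or 1, the defining expression is
    (a - 1) * (b - 1). *)
Lemma box_permissible_small l1 l2 a b : 0 < a -> 0 < b -> a <= l1 -> b <= l2 ->
  box_permissible l1 l2 a b.
Proof.
move=> a0 b0 al bl.
exists 1, [tuple (i < a : nat) | i < l1], [tuple (j < b : nat) | j < l2].
have sq n m : \sum_(i < n) tnth [tuple (i < m : nat) | i < n] i ^ 2 =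
    \sum_(i < n) (i < m).
  by apply: eq_bigr => i _; rewrite tnth_mktuple; case: (i < m).
split=> //.
- by under eq_bigr => i _ do rewrite tnth_mktuple; rewrite sum_ltn_ord ?muln1.
- by under eq_bigr => i _ do rewrite tnth_mktuple; rewrite sum_ltn_ord ?muln1.
- by rewrite !sq !sum_ltn_ord // muln1; nia.
by split=> i; rewrite tnth_mktuple muln1; case: (_ < _).
Qed.

(** Where the quadratic form is positive, the balanced partitions of
    sizes a * k and b * k work for k = l1 * l2. *)
Lemma box_permissible_pos l1 l2 a b : 0 < l1 -> 0 < l2 -> 0 < a -> 0 < b ->
    l2 * a ^ 2 + l1 * b ^ 2 < l1 * l2 * (a * b) ->
  box_permissible l1 l2 a b.
Proof.
move=> l1_gt0 l2_gt0 a0 b0 Qab;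
exists (l1 * l2), [tuple a * l2 | i < l1], [tuple b * l1 | j < l2].
have sumE n c (G : nat -> nat) : \sum_(i < n) G (tnth [tuple c | i < n] i) = n * G c.
  by under eq_bigr => i _ do rewrite tnth_mktuple; rewrite sum_nat_const card_ord.
split.
- by rewrite muln_gt0 l1_gt0.
- by rewrite (sumE l1 (a * l2) id) /=; ring.
- by rewrite (sumE l2 (b * l1) id) /=; ring.
- rewrite (sumE l1 (a * l2) (fun x => x ^ 2)) (sumE l2 (b * l1) (fun x => x ^ 2)).
  have := leq_mul (leqnn (l1 * l2)) Qab.
  by nia.
split=> i; rewrite tnth_mktuple.
  have : a < l1 * b.
    rewrite -(ltn_pmul2l (m := l2 * a)) ?muln_gt0 ?l2_gt0 //.
    apply: leq_ltn_trans (leq_trans Qab _); first by rewrite -mulnA mulnn leq_addr.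
    by nia.
  by nia.
have : b < l2 * a.
  rewrite -(ltn_pmul2l (m := l1 * b)) ?muln_gt0 ?l1_gt0 //.
  apply: leq_ltn_trans (leq_trans Qab _); first by rewrite -mulnA mulnn leq_addl.
  by nia.
by nia.
Qed.

(** If the quadratic form vanishes, a divides l1 and b divides l2. *)
Lemma box_permissible_null l1 l2 a b : 0 < l1 -> 0 < l2 -> 0 < a -> 0 < b ->
    coprime a b -> l2 * a ^ 2 + l1 * b ^ 2 = l1 * l2 * (a * b) ->
  box_permissible l1 l2 a b.
Proof.
move=> l1_gt0 l2_gt0 a0 b0 ab Qab; apply: box_permissible_small => //.
  apply: dvdn_leq => //; rewrite -(@Gauss_dvdl _ _ (b ^ 2)) ?coprimeXr //.
  rewrite -(@dvdn_addr (l2 * a ^ 2)) ?dvdn_mull ?dvdn_exp // Qab.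
  by rewrite dvdn_mull // dvdn_mulr.
apply: dvdn_leq => //; rewrite -(@Gauss_dvdl _ _ (a ^ 2)) ?coprimeXr 1?coprime_sym //.
rewrite -(@dvdn_addl (l1 * b ^ 2)) ?dvdn_mull ?dvdn_exp // Qab.
by rewrite dvdn_mull // dvdn_mull.
Qed.

Lemma coprime_reflect l a b : a <= l * b -> coprime a b -> coprime b (l * b - a).
Proof.
move=> al /eqP ab; rewrite /coprime -dvdn1 -ab dvdn_gcd dvdn_gcdl andbT.
by rewrite -[X in _ %| X](subKn al) dvdn_sub ?dvdn_gcdr // dvdn_mull ?dvdn_gcdl.
Qed.

(** N stands for the nontriviality of the wall function of (a, b). *)
Lemma reflection_permissible l1 l2 (N : nat -> nat -> Prop) :
    0 < l1 -> 0 < l2 ->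
    (forall a b, 0 < a -> 0 < b -> coprime a b -> N a b ->
      a <= l1 * b /\ (a < l1 * b -> N (l1 * b - a) b)) ->
    (forall a b, 0 < a -> 0 < b -> coprime a b -> N a b ->
      b <= l2 * a /\ (b < l2 * a -> N a (l2 * a - b))) ->
  forall a b, 0 < a -> 0 < b -> coprime a b -> N a b -> box_permissible l1 l2 a b.
Proof.
move=> l1_gt0 l2_gt0 N1 N2 a b; have [n] := ubnP (a + b).
elim: n a b => // n IHn a b abn a0 b0 ab Nab.
have [Qlt|Qgt|Qeq] := ltngtP (l2 * a ^ 2 + l1 * b ^ 2) (l1 * l2 * (a * b)).
- exact: box_permissible_pos.
(* The form is negative: one of the reflections decreases a + b. *)
- have [ab2|ab2] := ltnP (l1 * b) (2 * a).
    have [al N1ab] := N1 a b a0 b0 ab Nab.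
    have [aE|al'] := eqVneq a (l1 * b).
      have b1 : b = 1.
        by move: ab; rewrite aE coprimeMl /coprime gcdnn => /andP[_ /eqP].
      by apply: box_permissible_small => //; rewrite ?aE b1 // muln1.
    have lt : a < l1 * b by rewrite ltn_neqAle al'.
    apply: (@box_permissible_refl _ _ (l1 * b - a)); [by lia|by rewrite subnK|].
    apply: IHn => //; [by lia|by rewrite subn_gt0| |exact: N1ab].
    by rewrite coprime_sym; apply: coprime_reflect.
  have ba2 : l2 * a < 2 * b by nia.
  have [bl N2ab] := N2 a b a0 b0 ab Nab.
  have [bE|bl'] := eqVneq b (l2 * a).
    have a1 : a = 1.
      by move: ab; rewrite bE coprimeMr /coprime gcdnn => /andP[_ /eqP].
    by apply: box_permissible_small => //; rewrite ?bE a1 // muln1.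
  have lt : b < l2 * a by rewrite ltn_neqAle bl'.
  apply/box_permissibleC/(@box_permissible_refl _ _ (l2 * a - b));
    [by lia|by rewrite subnK|].
  apply/box_permissibleC/IHn => //; [by lia|by rewrite subn_gt0| |exact: N2ab].
  by apply: coprime_reflect; rewrite // coprime_sym.
exact: box_permissible_null.
Qed.

End Permissibility.

(** * Permissibility of the nontrivial rays *)

Section Reflections.
Variable C : numDomainType.
Variables (l1 l2 : nat) (S T : tvaut C) (th : int * int -> tvaut C).
Variable f : int * int -> tvring C.

Lemma factorization_reflection (a b : int) : (0 < l1)%N ->
    factorization l1 l2 S T th f -> first_quadrant_primitive (a, b) ->
    f (a, b) <> 1 ->
  a <= l1%:Z * b /\ (a < l1%:Z * b -> f (l1%:Z * b - a, b) <> 1).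
Proof.
move=> l1_gt0 fact; rewrite ray_first_quadrant => /andP[rab ab01] fab.
have rp := factorization_ray_product fact.
have Fab : ray_wall l2 f (a, b) <> 1 by rewrite /ray_wall (negPf ab01).
have [al Fab'] := ray_reflection rp l1_gt0 rab Fab; split=> // lt.
move: Fab'; rewrite /ray_wall /refl /= ifN //.
by rewrite xpair_eqE negb_and subr_eq0 gt_eqF.
Qed.

End Reflections.

Lemma factorization_reflection_swap (C : numDomainType) (l1 l2 : nat)
    (S T : tvaut C) (th : int * int -> tvaut C) (f : int * int -> tvring C)
    (a b : int) : (0 < l2)%N ->
    factorization l1 l2 S T th f -> first_quadrant_primitive (a, b) ->
    f (a, b) <> 1 ->
  b <= l2%:Z * a /\ (b < l2%:Z * a -> f (a, l2%:Z * a - b) <> 1).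
Proof.
move=> l2_gt0 /factorization_swap fact fqab fab.
have fqba : first_quadrant_primitive (b, a).
  by case/and3P: fqab => /= a0 b0 ab; apply/and3P; split; rewrite //= coprimez_sym.
have fba : tswap (f (a, b)) <> 1.
  by move=> /(congr1 (@tswap C)); rewrite tswapK rmorph1.
have [bl fba'] := factorization_reflection l2_gt0 fact fqba fba.
by split=> // /fba' fba1 fab1; apply: fba1; rewrite /swap fab1 rmorph1.
Qed.

Lemma permissible_box (l1 l2 a b : nat) :
    first_quadrant_primitive (a%:Z, b%:Z) -> box_permissible l1 l2 a b ->
  permissible l1 l2 (a%:Z, b%:Z).
Proof.
move=> fq [k [p [q [k0 sp sq le_pq _]]]]; split=> //; exists k, p, q.
have sumX n (r : n.-tuple nat) : \sum_(i < n) (tnth r i)%:Z ^+ 2 =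
    (\sum_(i < n) tnth r i ^ 2)%N%:Z.
  rewrite -[RHS]natz natr_sum; apply: eq_bigr => i _.
  by rewrite natrX natz.
split=> //=; rewrite ?sp ?sq ?PoszM // !sumX.
move: le_pq; set A := (\sum_(i < l1) _)%N; set B := (\sum_(i < l2) _)%N.
by move=> ?; nia.
Qed.

Theorem proposition4p4 (R : realType) (l1 l2 : nat)
    (f : int * int -> tvring (complex R)) (a b : int) :
  (0 < l1)%N -> (0 < l2)%N ->
  first_quadrant_primitive (a, b) ->
  is_commutator_factorization l1 l2 f ->
  f (a, b) <> 1 ->
  permissible l1 l2 (a, b).
Proof.
move=> l1_gt0 l2_gt0 fq /commutator_factorizationP[S [T [th fact]]].
have /and3P[/= + + _] := fq; case: a b fq => [a|//] [b|//] fq a0 b0.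
have fqE c d : (0 < c)%N -> (0 < d)%N -> coprime c d ->
    first_quadrant_primitive (c%:Z, d%:Z).
  by move=> c0 d0 cd; apply/and3P; split.
pose N c d := f (c%:Z, d%:Z) <> 1.
move=> fab; apply: permissible_box => //.
apply: (@reflection_permissible l1 l2 N) => //; last by case/and3P: fq.
- move=> c d c0 d0 cd Ncd.
  have [cl fcd] := factorization_reflection l1_gt0 fact (fqE c d c0 d0 cd) Ncd.
  have {}cl : (c <= l1 * d)%N by rewrite -lez_nat PoszM.
  by split=> // lt; rewrite /N -subzn // PoszM; apply: fcd; rewrite -PoszM ltz_nat.
move=> c d c0 d0 cd Ncd.
have [dl fcd] := factorization_reflection_swap l2_gt0 fact (fqE c d c0 d0 cd) Ncd.
have {}dl : (d <= l2 * c)%N by rewrite -lez_nat PoszM.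
by split=> // lt; rewrite /N -subzn // PoszM; apply: fcd; rewrite -PoszM ltz_nat.
Qed.
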